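(* Under the standing assumptions in the context, there are constants $c_7,c_8,c_9>0$ such that whenever $\mathcal F\in\mathcal W'$, $(\mathbf u,p)\in\mathcal W$ and $\mathcal A(\mathbf u,p)=\mathcal F$, with $\beta=\|\pi_1\mathcal F\|_{V'}$ and $\gamma=\|\pi_2\mathcal F\|_{Z'}$, one has $$\|\mathbf u\|_{L^s}\le c_7(\beta^{r-1}+\gamma^{r-1}+\gamma),\quad \|\operatorname{div}\mathbf u\|_{L^s}\le c_7\gamma,\quad \|p\|_{Z}\le c_7(\gamma^{r-1}+\gamma^{s-1}+\beta^{r-1}+\beta),$$ $$\|(\mathbf u,p)\|_{\mathcal W}\le c_8(\gamma^{r-1}+\gamma^{s-1}+\beta^{r-1}+\beta),\qquad \|(\mathbf u,p)\|_{\mathcal W}\le c_9(\|\mathcal F\|_{\mathcal W'}^{r-1}+\|\mathcal F\|_{\mathcal W'}^{s-1}).$$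
   Context: $n\ge2$, $\Omega\subset\mathbb R^n$ open bounded with $C^1$ boundary. $F:\mathbb R^n\to\mathbb R^n$ satisfies $F(0)=0$ and, for constants $s>2$, $c_1,c_2>0$ and all $x,y$: $|F(x)-F(y)|\le c_1(1+|x|^{s-2}+|y|^{s-2})|x-y|$ and $(F(x)-F(y))\cdot(x-y)\ge c_2|x-y|^s$. Let $r=s/(s-1)$. $V=\mathbf W_s(\mathrm{div},\Omega)=\{\mathbf v\in(L^s(\Omega))^n:\operatorname{div}\mathbf v\in L^s(\Omega)\}$ with norm $(\|\mathbf v\|_{L^s}^s+\|\operatorname{div}\mathbf v\|_{L^s}^s)^{1/s}$, $Z=L^r(\Omega)$, and $\mathcal W=V\times Z$ with norm $\|(\mathbf u,p)\|_{\mathcal W}=\|\mathbf u\|_V+\|p\|_Z$. Set $a(\mathbf u,\mathbf v)=\int_\Omega F(\mathbf u)\cdot\mathbf v\,dx$, $b(\mathbf v,q)=\int_\Omega(\operatorname{div}\mathbf v)q\,dx$, and $\mathcal A:\mathcal W\to\mathcal W'$ by $\langle\mathcal A(\mathbf u,p),(\mathbf v,q)\rangle=a(\mathbf u,\mathbf v)-b(\mathbf v,p)+b(\mathbf u,q)$. For $\mathcal F\in\mathcal W'$, $\pi_1\mathcal F\in V'$ and $\pi_2\mathcal F\in Z'$ are $(\pi_1\mathcal F)(\mathbf v)=\mathcal F(\mathbf v,0)$ and $(\pi_2\mathcal F)(q)=\mathcal F(0,q)$. *)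

(* Defs.v *)
From HB Require Import structures.
From mathcomp Require Import all_boot all_order all_algebra.
From mathcomp Require Import all_classical all_reals all_analysis.
Set Implicit Arguments. Unset Strict Implicit. Unset Printing Implicit Defensive.
Import Order.TTheory GRing.Theory Num.Theory.
Import numFieldNormedType.Exports.
Local Open Scope classical_set_scope.
Local Open Scope ring_scope.

Section Defs.
Variables (R : realType) (n : nat).

Notation Rn := 'rV[R]_n.

Definition edot (x y : Rn) : R := \sum_(i < n) x 0 i * y 0 i.
Definition enorm (x : Rn) : R := Num.sqrt (edot x x).

Definition ebasis (i : 'I_n) : Rn := delta_mx 0 i.

Definition BRn := g_sigma_algebraType (@open Rn).

(* mu is the Lebesgue measure on (the Borel sets of) R^n:
   it gives to every closed box its Euclidean volume
   (this characterizes the Lebesgue measure on Borel sets). *)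
Definition is_lebesgue (mu : {measure set BRn -> \bar R}) : Prop :=
  forall a b : Rn, (forall i, a 0 i <= b 0 i) ->
    mu [set x : BRn | forall i, a 0 i <= (x : Rn) 0 i <= b 0 i]
    = (\prod_(i < n) (b 0 i - a 0 i))%:E.

Fixpoint pder (l : seq 'I_n) (phi : Rn -> R) : Rn -> R :=
  match l with
  | [::] => phi
  | i :: l' => fun x => 'D_(ebasis i) (pder l' phi) x
  end.

Definition smooth (phi : Rn -> R) : Prop :=
  forall l : seq 'I_n, continuous (pder l phi) /\
    forall (i : 'I_n) (x : Rn), derivable (pder l phi) x (ebasis i).

Definition test_fun (Om : set Rn) (phi : Rn -> R) : Prop :=
  smooth phi /\
  exists K : set Rn, [/\ compact K, K `<=` Om & forall x, ~ K x -> phi x = 0].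

Definition grad (phi : Rn -> R) (x : Rn) : Rn := \row_(i < n) 'D_(ebasis i) phi x.

Definition C1fun (g : Rn -> R) : Prop :=
  forall i : 'I_n, (forall x, derivable g x (ebasis i)) /\
                   continuous (fun x => 'D_(ebasis i) g x).

(* Omega has C^1 boundary: near each boundary point, after an orthogonal
   change of coordinates Q, Omega is the strict subgraph (in the direction
   of coordinate k) of a C^1 function not depending on coordinate k. *)
Definition C1_boundary (Om : set Rn) : Prop :=
  forall x0 : Rn, closure Om x0 -> ~ Om x0 ->
    exists (r : R) (Q : 'M[R]_n) (k : 'I_n) (g : Rn -> R),
      [/\ 0 < r, Q *m Q^T = 1%:M, C1fun g,
          (forall (y : Rn) (t : R), g (y + t *: ebasis k) = g y) &
          forall x : Rn, ball x0 r x -> (Om x <-> (x *m Q) 0 k < g (x *m Q))].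

Variable mu : {measure set BRn -> \bar R}.
Variable Om : set Rn.

Definition Lmem (p : R) (f : Rn -> R) : Prop :=
  measurable_fun (Om : set BRn) (f : BRn -> R) /\
  mu.-integrable (Om : set BRn) (fun x : BRn => (`|f x| `^ p)%:E).

Definition Lnrm (p : R) (f : Rn -> R) : R :=
  (Rintegral mu (Om : set BRn) (fun x : BRn => `|f x| `^ p)) `^ (p^-1).

Definition Lmem_vec (p : R) (v : Rn -> Rn) : Prop :=
  (forall i : 'I_n, measurable_fun (Om : set BRn) (fun x : BRn => v x 0 i)) /\
  mu.-integrable (Om : set BRn) (fun x : BRn => (enorm (v x) `^ p)%:E).

Definition Lnrm_vec (p : R) (v : Rn -> Rn) : R := Lnrm p (fun x => enorm (v x)).

Definition weak_div (v : Rn -> Rn) (g : Rn -> R) : Prop :=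
  forall phi, test_fun Om phi ->
    Rintegral mu (Om : set BRn) (fun x : BRn => edot (v x) (grad phi x))
    = - Rintegral mu (Om : set BRn) (fun x : BRn => g x * phi x).

Definition Vmem (s : R) (v : Rn -> Rn) (g : Rn -> R) : Prop :=
  [/\ Lmem_vec s v, Lmem s g & weak_div v g].

Definition Vnrm (s : R) (v : Rn -> Rn) (g : Rn -> R) : R :=
  (Lnrm_vec s v `^ s + Lnrm s g `^ s) `^ (s^-1).

Definition Wdual (s r : R) (Fc : (Rn -> Rn) -> (Rn -> R) -> R) : Prop :=
  (forall (a b : R) v1 g1 q1 v2 g2 q2,
      Vmem s v1 g1 -> Lmem r q1 -> Vmem s v2 g2 -> Lmem r q2 ->
      Fc (fun x => a *: v1 x + b *: v2 x) (fun x => a * q1 x + b * q2 x)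
      = a * Fc v1 q1 + b * Fc v2 q2) /\
  exists C : R, forall v g q, Vmem s v g -> Lmem r q ->
      `|Fc v q| <= C * (Vnrm s v g + Lnrm r q).

Definition dnorm_pi1 (s r : R) (Fc : (Rn -> Rn) -> (Rn -> R) -> R) : R :=
  sup [set `|Fc v (fun=> 0)| | v in [set v | exists g, Vmem s v g /\ Vnrm s v g <= 1]].

Definition dnorm_pi2 (s r : R) (Fc : (Rn -> Rn) -> (Rn -> R) -> R) : R :=
  sup [set `|Fc (fun=> 0) q| | q in [set q | Lmem r q /\ Lnrm r q <= 1]].

Definition dnorm_W (s r : R) (Fc : (Rn -> Rn) -> (Rn -> R) -> R) : R :=
  sup [set `|Fc vq.1 vq.2| | vq in
        [set vq | exists g, [/\ Vmem s vq.1 g, Lmem r vq.2 &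
                               Vnrm s vq.1 g + Lnrm r vq.2 <= 1]]].

(* A(u,p) = F, where gu = div u:
   a(u,v) - b(v,p) + b(u,q) = F(v,q) for all (v,q) in W *)
Definition solves (s r : R) (Fn : Rn -> Rn) (Fc : (Rn -> Rn) -> (Rn -> R) -> R)
  (u : Rn -> Rn) (gu : Rn -> R) (p : Rn -> R) : Prop :=
  forall v gv q, Vmem s v gv -> Lmem r q ->
    Rintegral mu (Om : set BRn) (fun x : BRn => edot (Fn (u x)) (v x))
    - Rintegral mu (Om : set BRn) (fun x : BRn => gv x * p x)
    + Rintegral mu (Om : set BRn) (fun x : BRn => gu x * q x)
    = Fc v q.

End Defs.

(* Main.v *)
(** Testing with [q] a power of [div u] gives [|div u| <= gamma], and testing with
    [v = u] gives the energy inequality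
    [c2 U^s <= beta (U + |div u|) + |div u| P], where [U = |u|_s] and [P = |p|_r].
    To bound [P], test with a [v] whose divergence is [sgn p |p|^(r-1)].  Such a [v]
    is explicit: extend the right-hand side [g] by zero and let
    [v x = (\int_0^L g (x - t e_1) dt) e_1] with [L] larger than the diameter.
    By Fubini's theorem and translation invariance of the measure, [div v = g] and
    [|v|_s <= L |g|_s].  Hence [P <= C (U + U^(s-1) + beta)], and the rest is an
    elementary argument with powers. *)

Require Import Defs.
From HB Require Import structures.
From mathcomp Require Import all_boot all_order all_algebra.
From mathcomp Require Import all_classical all_reals all_analysis.
From mathcomp Require Import measurable_realfun ring lra.
Import Order.TTheory GRing.Theory Num.Theory.
Import numFieldNormedType.Exports.
Local Open Scope classical_set_scope.
Local Open Scope ring_scope.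

Set Implicit Arguments. Unset Strict Implicit. Unset Printing Implicit Defensive.

(** * Borel sets of R^n and translation invariance *)

(** The obstacle is a coupling: through |div u| P the bound on P brings U^(s-1) back into the
    estimate of U^s. The loop closes because |div u| <= gamma is known independently, so this term
    is at most C gamma (U + U^(s-1) + beta), of degree s - 1 < s in U. Comparing c2 U^s with each
    term gives a threshold for U: beta U yields beta^(1/(s-1)), gamma U yields gamma^(1/(s-1)), and
    gamma U^(s-1) yields gamma. As 1/(s-1) = r - 1, these are the three terms in the bound on U; the
    (s-1)-th power of the last one is the gamma^(s-1) in the bound on p. Since v has a single
    nonzero component, its weak divergence involves only the derivative of test functions along that
    axis, which is integrated exactly by the fundamental theorem of calculus. The measure is given
    only by its values on boxes, so translation invariance is itself derived, from the uniqueness of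
    a measure on a generating family stable under intersection. *)

Section Borel.
Variables (R : realType) (n : nat).
Notation Rn := 'rV[R]_n.

Definition box (a b : Rn) : set (BRn R n) :=
  [set x : BRn R n | forall i, a 0 i <= (x : Rn) 0 i <= b 0 i].

Definition boxes : set (set (BRn R n)) := [set box ab.1 ab.2 | ab in setT].

Lemma open_measurable_Rn (O : set Rn) :
  open O -> measurable (O : set (BRn R n)).
Proof. by move=> oO; exact: sub_sigma_algebra. Qed.

Lemma continuous_measurable_Rn (f : Rn -> R) :
  continuous f -> measurable_fun [set: BRn R n] (f : BRn R n -> R).
Proof.
move=> /continuousP cf.
apply: (measurability _ (RGenOpens.measurableE R)).
move=> _ [_ [a [b ->] <-]]; rewrite setTI; apply: open_measurable_Rn.
exact/cf/interval_open.
Qed.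

Lemma measurable_coord (i : 'I_n) :
  measurable_fun [set: BRn R n] (fun x : BRn R n => (x : Rn) 0 i).
Proof.
apply: (@continuous_measurable_Rn (fun M : Rn => M 0 i)).
exact: coord_continuous.
Qed.

(** Balls of the sup norm are boxes, so rational corners can be chosen strictly within [e] of [x].
    Pairs of rational row vectors are countably many; a box not included in [O] contributes the
    empty set. *)
Lemma open_bigcup_boxes (O : set Rn) : open O ->
  O = \bigcup_(ab : 'rV[rat]_n * 'rV[rat]_n)
        [set x | box (map_mx ratr ab.1) (map_mx ratr ab.2) `<=` O /\
                 box (map_mx ratr ab.1) (map_mx ratr ab.2) x].
Proof.
move=> oO; apply/seteqP; split => [x Ox|x [ab _ [+]]]; last exact.
move: (oO); rewrite openE => /(_ x Ox) /nbhs_ballP[e /= e0 eO].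
have qa i : exists q : rat, ratr q \in `](x 0 i - e), (x 0 i)[.
  by apply: rat_in_itvoo; rewrite ltrBlDr ltrDl.
have qb i : exists q : rat, ratr q \in `](x 0 i), (x 0 i + e)[.
  by apply: rat_in_itvoo; rewrite ltrDl.
pose a : 'rV[rat]_n := \row_i projT1 (cid (qa i)).
pose b : 'rV[rat]_n := \row_i projT1 (cid (qb i)).
have aP i : ratr (a 0 i) \in `](x 0 i - e), (x 0 i)[.
  by rewrite mxE; case: cid.
have bP i : ratr (b 0 i) \in `](x 0 i), (x 0 i + e)[.
  by rewrite mxE; case: cid.
exists (a, b) => //; split=> [y yab /=|i]; last first.
  have := aP i; have := bP i; rewrite !in_itv /= !mxE.
  by move=> /andP[/ltW -> _] /andP[_ /ltW ->].
apply: eO; split=> // i j; rewrite (ord1 i).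
have := aP j; have := bP j; have := yab j; rewrite !in_itv /= !mxE.
move=> /andP[y1 y2] /andP[x1 x2] /andP[x3 x4].
rewrite /ball /= ltr_distlC; apply/andP; split.
  exact: lt_le_trans x3 y1.
exact: le_lt_trans y2 x2.
Qed.

Lemma boxes_measurable (a b : Rn) : measurable (box a b).
Proof.
rewrite [X in measurable X](_ : _ =
    \bigcap_(i in [set: 'I_n]) ((fun x : BRn R n => (x : Rn) 0 i) @^-1` `[a 0 i, b 0 i])).
  apply: fin_bigcap_measurable => // i _.
  by rewrite -[X in measurable X]setTI; exact: measurable_coord.
apply/seteqP; split => x /=.
  by move=> h i _ /=; rewrite in_itv /=.
by move=> h i; have := h i I; rewrite /= in_itv.
Qed.

(** [is_lebesgue] speaks of boxes only. This identity lets uniqueness of measures be checked on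
    them, and measurability of maps into R^n coordinate by coordinate. *)
Lemma measurable_boxesE : @measurable _ (BRn R n) = <<s boxes >>.
Proof.
apply/seteqP; split.
  apply: smallest_sub; first exact: smallest_sigma_algebra.
  move=> O oO; rewrite (open_bigcup_boxes oO).
  apply: (@countable_bigcupT_measurable _ (g_sigma_algebraType boxes)).
    exact: countableP.
  move=> ab; case: (pselect (box (map_mx ratr ab.1) (map_mx ratr ab.2) `<=` O)) => h.
    rewrite [X in measurable X](_ : _ = box (map_mx ratr ab.1) (map_mx ratr ab.2)).
      by apply: sub_sigma_algebra; exists (map_mx ratr ab.1, map_mx ratr ab.2).
    by apply/seteqP; split => x //= -[].
  by rewrite [X in measurable X](_ : _ = set0) // -subset0 => x [].
apply: smallest_sub; first exact: sigma_algebra_measurable.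
by move=> _ [ab _ <-]; exact: boxes_measurable.
Qed.

Lemma measurable_fun_Rn d (T : measurableType d) (D : set T) (f : T -> Rn) :
  measurable D -> (forall i, measurable_fun D (fun t => f t 0 i)) ->
  measurable_fun D (f : T -> BRn R n).
Proof.
move=> mD mf; apply: (measurability _ measurable_boxesE).
move=> _ [_ [ab _ <-] <-].
(* The last intersection with [D] covers n = 0, where the intersection over the coordinates is the
   whole space. *)
rewrite [X in measurable X](_ : _ =
    \bigcap_(i in [set: 'I_n]) (D `&` (fun t => f t 0 i) @^-1` `[ab.1 0 i, ab.2 0 i]) `&` D).
  apply: measurableI => //; apply: fin_bigcap_measurable => // i _.
  by apply: mf.
apply/seteqP; split => x /=.
  by move=> [Dx h]; split=> // i _ /=; split=> //; rewrite in_itv /=.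
by move=> [h Dx]; split=> // i; have := h i I; rewrite /= in_itv => -[].
Qed.

Lemma measurable_fun_Rn_comp (D : set Rn) (u : Rn -> Rn) (f : Rn -> R) :
  measurable (D : set (BRn R n)) -> continuous f ->
  (forall i, measurable_fun (D : set (BRn R n)) (fun x : BRn R n => u x 0 i)) ->
  measurable_fun (D : set (BRn R n)) (fun x : BRn R n => f (u x)).
Proof.
move=> mD cf mu.
apply: (measurableT_comp (f := (f : BRn R n -> R)) (g := (u : BRn R n -> BRn R n))).
  exact: continuous_measurable_Rn.
exact: measurable_fun_Rn.
Qed.

Lemma measurable_shift (h : Rn) :
  measurable_fun [set: BRn R n] ((fun x : Rn => x + h) : BRn R n -> BRn R n).
Proof.
apply: measurable_fun_Rn => // i.
rewrite [X in measurable_fun _ X](_ : _ = (fun x : BRn R n => (x : Rn) 0 i + h 0 i)).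
  by apply: measurable_funD => //; exact: measurable_coord.
by apply/funext => x; rewrite mxE.
Qed.

Definition cube (k : nat) : set (BRn R n) := box (const_mx (- k%:R)) (const_mx k%:R).

Lemma bigcup_cube : \bigcup_k cube k = setT.
Proof.
apply/seteqP; split=> // x _.
pose M := \sum_(i < n) `|(x : Rn) 0 i|.
have M0 : 0 <= M by apply: sumr_ge0.
have [k Mk] : exists k : nat, M <= k%:R.
  by exists (Num.truncn M).+1; apply/ltW/truncnS_gt.
exists k => // i; rewrite !mxE -ler_norml; apply: le_trans Mk.
by rewrite /M (bigD1 i) //= lerDl; apply: sumr_ge0.
Qed.

Lemma setI_closed_boxes : setI_closed boxes.
Proof.
move=> _ _ [[a b] _ <-] [[a' b'] _ <-] /=.
exists (\row_i Num.max (a 0 i) (a' 0 i), \row_i Num.min (b 0 i) (b' 0 i)) => //=.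
apply/seteqP; split=> x /=.
  move=> h; split => i; have := h i; rewrite !mxE ge_max le_min.
    by move=> /andP[/andP[-> _] /andP[-> _]].
  by move=> /andP[/andP[_ ->] /andP[_ ->]].
move=> [h1 h2] i; rewrite !mxE ge_max le_min.
by have /andP[-> ->] := h1 i; have /andP[-> ->] := h2 i.
Qed.

Variable mu : {measure set (BRn R n) -> \bar R}.
Hypothesis leb : is_lebesgue mu.

Lemma cube_lty k : (mu (cube k) < +oo)%E.
Proof.
rewrite /cube leb ?ltry// => i; rewrite !mxE.
by rewrite lerNl (@le_trans _ _ 0) // ?oppr_le0.
Qed.

Lemma sigma_finite_lebesgue : sigma_finite setT mu.
Proof.
exists cube; first by rewrite bigcup_cube.
by move=> k; split; [exact: boxes_measurable|exact: cube_lty].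
Qed.

(** The measure and its translate agree on boxes, which are stable under intersection and generate
    the Borel sets; the cubes exhaust the space with finite measure, so uniqueness applies. *)
Lemma lebesgue_shift (h : Rn) (A : set (BRn R n)) : measurable A ->
  pushforward mu ((fun x : Rn => x + h) : BRn R n -> BRn R n) A = mu A.
Proof.
move=> mA; apply/esym.
pose mh := isMeasurableFun.Build _ _ _ _ _ (measurable_shift h).
pose ph : {mfun BRn R n >-> BRn R n} :=
  HB.pack ((fun x : Rn => x + h) : BRn R n -> BRn R n) mh.
apply: (measure_unique boxes cube measurable_boxesE setI_closed_boxes
  _ bigcup_cube mu (pushforward mu ph) _ cube_lty _ mA).
  by move=> k; exists (const_mx (- k%:R), const_mx k%:R).
move=> _ [[a b] _ <-] /=; rewrite /pushforward /=.
have -> : (fun x : Rn => x + h) @^-1` box a b = box (a - h) (b - h) :> set (BRn R n).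
  apply/seteqP; split=> x /= H i; have := H i; rewrite !mxE;
    by rewrite lerBlDr lerBrDr.
case: (pselect (forall i, a 0 i <= b 0 i)) => ab.
  rewrite !leb //.
    by congr EFin; apply: eq_bigr => i _; rewrite !mxE; lra.
  by move=> i; rewrite !mxE lerD2r.
(* [is_lebesgue] is silent on corners in the wrong order, but such boxes are empty, before and after
   translation. *)
have e (a' b' : Rn) : ~ (forall i, a' 0 i <= b' 0 i) -> box a' b' = set0.
  move=> nab; rewrite -subset0 => x H; apply: nab => i.
  by have /andP[] := H i; exact: le_trans.
rewrite (e _ _ ab) e // => H; apply: ab => i.
by have := H i; rewrite !mxE lerD2r.
Qed.

Lemma ge0_integral_shift (h : Rn) (f : BRn R n -> \bar R) :
  measurable_fun setT f -> (forall x, 0 <= f x)%E ->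
  (\int[mu]_x f ((x : Rn) + h)%R = \int[mu]_x f x)%E.
Proof.
move=> mf f0.
transitivity (\int[pushforward mu ((fun x : Rn => x + h)%R : BRn R n -> BRn R n)]_x f x)%E.
  by rewrite (ge0_integral_pushforward (measurable_shift h)) ?preimage_setT.
pose mh := isMeasurableFun.Build _ _ _ _ _ (measurable_shift h).
pose ph : {mfun BRn R n >-> BRn R n} :=
  HB.pack ((fun x : Rn => x + h)%R : BRn R n -> BRn R n) mh.
apply: (@eq_measure_integral _ _ _ _ mu (pushforward mu ph)) => A mA _.
exact: lebesgue_shift.
Qed.

(** No integrability is assumed, the integral being the difference of those of the positive and
    negative parts. *)
Lemma integral_shift (h : Rn) (f : BRn R n -> \bar R) :
  measurable_fun setT f ->
  (\int[mu]_x f ((x : Rn) + h)%R = \int[mu]_x f x)%E.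
Proof.
move=> mf; rewrite [LHS]integralE [RHS]integralE; congr (_ - _)%E.
  rewrite -[RHS](@ge0_integral_shift h); first
    by apply: eq_integral => x _; rewrite funeposE funeposE.
    exact: measurable_funepos.
  by move=> x; exact: funepos_ge0.
rewrite -[RHS](@ge0_integral_shift h); first
  by apply: eq_integral => x _; rewrite funenegE funenegE.
  exact: measurable_funeneg.
by move=> x; exact: funeneg_ge0.
Qed.

Lemma ler_coord_norm (x : Rn) (i : 'I_n) : `|x 0 i| <= `|x|.
Proof.
by rewrite [leRHS]/Num.norm /= mx_normrE;
  exact: (le_bigmax _ (fun j : 'I_1 * 'I_n => `|x j.1 j.2|) (0, i)).
Qed.

Lemma bounded_lebesgue_lty (D : set Rn) : measurable (D : set (BRn R n)) ->
  bounded_set D -> (mu (D : set (BRn R n)) < +oo)%E.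
Proof.
move=> mD [M [Mreal bD]].
pose k := (Num.truncn (`|M| + 1)).+1.
have kM : `|M| + 1 < k%:R by exact: truncnS_gt.
apply: le_lt_trans (cube_lty k); apply: le_measure; rewrite ?inE //.
  exact: boxes_measurable.
move=> x Dx i; rewrite !mxE -ler_norml.
apply: le_trans (ltW kM).
have : `|x| <= `|M| + 1 by apply: bD => //; rewrite ltr_pwDr // ler_norm.
exact: le_trans (ler_coord_norm _ _).
Qed.

End Borel.

(** * Integrals of powers *)

Lemma powR_le1 (R : realType) (y p : R) : 0 <= y -> 0 <= p -> y <= 1 -> y `^ p <= 1.
Proof.
move=> y0 p0 y1; have := @ge0_ler_powR R p p0 y 1; rewrite powR1 !nnegrE.
by apply.
Qed.

Section Hoelder.
Variables (R : realType) (d : measure_display) (T : measurableType d).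
Variables (mu : {measure set T -> \bar R}) (D : set T).
Hypothesis mD : measurable D.
Implicit Types f g : T -> R.

Lemma measurable_norm_powR f (p : R) : measurable_fun D f ->
  measurable_fun D (fun x => `|f x| `^ p).
Proof.
move=> mf; apply: (measurableT_comp (f := fun y : R => y `^ p)).
  exact: measurable_powR.
exact: measurableT_comp.
Qed.

Lemma le_integrable_EFin f g : measurable_fun D f ->
  (forall x, D x -> `|f x| <= g x) ->
  mu.-integrable D (fun x => (g x)%:E) -> mu.-integrable D (fun x => (f x)%:E).
Proof.
move=> mf fg; apply: le_integrable => //; first exact/measurable_EFinP.
move=> x Dx /=; rewrite lee_fin; apply: le_trans (fg _ Dx) _.
exact: ler_norm.
Qed.

Lemma Lnorm_powK f (p : R) : p != 0 ->
  ((\int[mu]_(x in D) `|f x| `^ p) `^ p^-1) `^ p = \int[mu]_(x in D) `|f x| `^ p.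
Proof.
by move=> p0; rewrite -powRrM mulVf // powRr1 // Rintegral_ge0 // => x _; exact: powR_ge0.
Qed.

Lemma hoelder_integrable f g (p q : R) : 0 < p -> 0 < q -> p^-1 + q^-1 = 1 ->
  measurable_fun D f -> measurable_fun D g ->
  mu.-integrable D (fun x => (`|f x| `^ p)%:E) ->
  mu.-integrable D (fun x => (`|g x| `^ q)%:E) ->
  mu.-integrable D (fun x => (f x * g x)%:E).
Proof.
move=> p0 q0 pq mf mg intf intg.
apply: (@le_integrable_EFin _ (fun x => p^-1 * `|f x| `^ p + q^-1 * `|g x| `^ q)).
- exact: measurable_funM.
- move=> x _; rewrite normrM [X in X + _]mulrC [X in _ + X]mulrC.
  exact: conjugate_powR.
- under eq_fun do rewrite EFinD !EFinM.
  by apply: integrableD => //; exact: integrableZl.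
Qed.

(** Young's inequality is integrated after dividing |f| by A + e and |g| by B + e. The shift by e >
    0 avoids a separate case for a vanishing norm; e then tends to 0. *)
Lemma hoelder_Rintegral f g (p q : R) : 0 < p -> 0 < q -> p^-1 + q^-1 = 1 ->
  measurable_fun D f -> measurable_fun D g ->
  mu.-integrable D (fun x => (`|f x| `^ p)%:E) ->
  mu.-integrable D (fun x => (`|g x| `^ q)%:E) ->
  \int[mu]_(x in D) (`|f x| * `|g x|) <=
  (\int[mu]_(x in D) `|f x| `^ p) `^ p^-1 * (\int[mu]_(x in D) `|g x| `^ q) `^ q^-1.
Proof.
move=> p0 q0 pq mf mg intf intg.
set A := (X in X * _); set B := (X in _ <= _ * X).
have A0 : 0 <= A by exact: powR_ge0.
have B0 : 0 <= B by exact: powR_ge0.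
have Ap : A `^ p = \int[mu]_(x in D) `|f x| `^ p by rewrite Lnorm_powK ?gt_eqF.
have Bq : B `^ q = \int[mu]_(x in D) `|g x| `^ q by rewrite Lnorm_powK ?gt_eqF.
clearbody A B.
have ifg : mu.-integrable D (fun x => (`|f x| * `|g x|)%:E).
  apply: (@hoelder_integrable (fun x => `|f x|) (fun x => `|g x|) p q) => //.
  - exact: measurableT_comp.
  - exact: measurableT_comp.
  - by under eq_fun do rewrite normr_id.
  - by under eq_fun do rewrite normr_id.
have key (e : R) : 0 < e -> \int[mu]_(x in D) (`|f x| * `|g x|) <= (A + e) * (B + e).
  move=> e0.
  have ae : 0 < A + e by rewrite ltr_wpDl.
  have be : 0 < B + e by rewrite ltr_wpDl.
  rewrite -[leRHS]mulr1 -ler_pdivrMl ?mulr_gt0 // -RintegralZl //.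
  have cA : 0 <= (A + e)^-1 by rewrite invr_ge0 ltW.
  have cB : 0 <= (B + e)^-1 by rewrite invr_ge0 ltW.
  have le1 : (A + e)^-1 `^ p * A `^ p <= 1.
    rewrite -powRM //; apply: powR_le1; [by rewrite mulr_ge0|exact: ltW|].
    by rewrite ler_pdivrMl // mulr1 lerDl ltW.
  have le2 : (B + e)^-1 `^ q * B `^ q <= 1.
    rewrite -powRM //; apply: powR_le1; [by rewrite mulr_ge0|exact: ltW|].
    by rewrite ler_pdivrMl // mulr1 lerDl ltW.
  pose cp := (A + e)^-1 `^ p / p; pose cq := (B + e)^-1 `^ q / q.
  have i1 : mu.-integrable D (fun x => (cp * `|f x| `^ p)%:E).
    by under eq_fun do rewrite EFinM; exact: integrableZl.
  have i2 : mu.-integrable D (fun x => (cq * `|g x| `^ q)%:E).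
    by under eq_fun do rewrite EFinM; exact: integrableZl.
  have i3 : mu.-integrable D (fun x => (cp * `|f x| `^ p + cq * `|g x| `^ q)%:E).
    by under eq_fun do rewrite EFinD; exact: integrableD.
  have i4 : mu.-integrable D
      (fun x => (((A + e) * (B + e))^-1 * (`|f x| * `|g x|))%:E).
    by under eq_fun do rewrite EFinM; exact: integrableZl.
  apply: (@le_trans _ _ (\int[mu]_(x in D) (cp * `|f x| `^ p + cq * `|g x| `^ q))).
    apply: le_Rintegral => // x _.
    have -> : ((A + e) * (B + e))^-1 * (`|f x| * `|g x|) =
              ((A + e)^-1 * `|f x|) * ((B + e)^-1 * `|g x|).
      by rewrite invfM; ring.
    apply: le_trans (conjugate_powR _ _ p0 q0 pq) _; rewrite ?mulr_ge0 //.
    by rewrite !powRM // /cp /cq (mulrAC _ p^-1) (mulrAC _ q^-1).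
  rewrite RintegralD // !RintegralZl // -Ap -Bq -pq /cp /cq.
  rewrite (mulrAC _ p^-1) (mulrAC _ q^-1) lerD //.
    by apply: ler_piMl => //; rewrite invr_ge0 ltW.
  by apply: ler_piMl => //; rewrite invr_ge0 ltW.
apply/ler_addgt0Pr => e e0.
(* From k <= 1 follows (A + k)(B + k) <= AB + k (A + B + 1), and the second entry makes the last
   term at most [e]. *)
pose k := Num.min 1 (e / (A + B + 1)).
have AB1 : 0 < A + B + 1 by rewrite ltr_wpDl ?addr_ge0.
have k0 : 0 < k by rewrite lt_min ltr01 divr_gt0.
have k1 : k <= 1 by rewrite ge_min lexx.
have k2 : k * (A + B + 1) <= e by rewrite -ler_pdivlMr // ge_min lexx orbT.
apply: le_trans (key k k0) _; apply: le_trans (lerD (lexx (A * B)) k2).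
have -> : (A + k) * (B + k) = A * B + k * (A + B + k) by ring.
by rewrite lerD2l ler_pM2l // lerD2l.
Qed.

End Hoelder.

(** * Powers realising the duality of L^p and L^q *)

Section Duality.
Variables (R : realType) (d : measure_display) (T : measurableType d).
Variables (mu : {measure set T -> \bar R}) (D : set T).
Hypothesis mD : measurable D.

(** This is sgn(f) |f|^(p-1) without a sign function: at a zero of [f] the first factor annihilates
    whatever value the power takes there, also when p < 2. *)
Definition dual_power (p : R) (f : T -> R) : T -> R :=
  fun x => f x * `|f x| `^ (p - 2).

Lemma norm_mul_powR (y p : R) : 1 < p -> `|y| * `|y| `^ (p - 2) = `|y| `^ (p - 1).
Proof.
move=> p1; have [->|y0] := eqVneq y 0.
  by rewrite normr0 mul0r powR0 // subr_eq0 gt_eqF.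
have ny : `|y| != 0 by rewrite normr_eq0.
by rewrite -{1}(powRr1 (normr_ge0 y)) -powRD ?ny ?implybT //; congr (_ `^ _); lra.
Qed.

Lemma norm_dual_power (p : R) f x : 1 < p ->
  `|dual_power p f x| = `|f x| `^ (p - 1).
Proof.
by move=> p1; rewrite normrM (ger0_norm (powR_ge0 _ _)) norm_mul_powR.
Qed.

Lemma mul_dual_power (p : R) f x : 1 < p -> f x * dual_power p f x = `|f x| `^ p.
Proof.
move=> p1; rewrite /dual_power mulrA -expr2 -real_normK ?num_real // expr2 -mulrA.
rewrite norm_mul_powR //; have [->|y0] := eqVneq (f x) 0.
  by rewrite normr0 mul0r powR0 // gt_eqF // (lt_trans _ p1).
have ny : `|f x| != 0 by rewrite normr_eq0.
by rewrite -{1}(powRr1 (normr_ge0 (f x))) -powRD ?ny ?implybT //; congr (_ `^ _); lra.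
Qed.

Lemma norm_dual_power_pow (p q : R) f x : 1 < p -> (p - 1) * q = p ->
  `|dual_power p f x| `^ q = `|f x| `^ p.
Proof. by move=> p1 pq; rewrite norm_dual_power // -powRrM pq. Qed.

Lemma measurable_dual_power (p : R) f : measurable_fun D f ->
  measurable_fun D (dual_power p f).
Proof.
by move=> mf; apply: measurable_funM => //; exact: measurable_norm_powR.
Qed.

End Duality.

(** * A right inverse of the divergence *)

Section Lines.
Variables (R : realType) (n : nat) (mu : {measure set (BRn R n) -> \bar R}).
Hypothesis leb : is_lebesgue mu.
Variables (i : 'I_n) (L : R).
Hypothesis L0 : 0 < L.
Notation Rn := 'rV[R]_n.
Notation e := (ebasis R i).
Notation lam := (@lebesgue_measure R).

Lemma sfinite_lebesgue : sfinite_measure mu.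
Proof. exact/sfinite_measure_sigma_finite/sigma_finite_lebesgue. Qed.

(** The same measure with the structure that Fubini and Tonelli require; integrals against it and
    against [mu] are convertible. *)
Definition sigma_finite_leb : {sigma_finite_measure set (BRn R n) -> \bar R} :=
  HB.pack (Measure.sort mu)
    (@isSFinite.Build _ _ _ (Measure.sort mu) sfinite_lebesgue)
    (@isSigmaFinite.Build _ _ _ (Measure.sort mu) (sigma_finite_lebesgue leb)).

(** Weighting by this indicator keeps the integrals in t over the whole line, so that Fubini is
    applied on the full product space. *)
Definition chi (t : R) : R := \1_(`[0, L]%classic : set R) t.

Lemma chi_ge0 t : 0 <= chi t.
Proof. by rewrite /chi indicE. Qed.

Lemma chi_powR (t p : R) : p != 0 -> chi t `^ p = chi t.
Proof.
by move=> p0; rewrite /chi indicE; case: (_ \in _); rewrite ?powR1 ?powR0.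
Qed.

Lemma measurable_chi (D : set R) : measurable_fun D chi.
Proof. exact: measurable_indic. Qed.

Lemma integral_chi (f : R -> R) :
  (\int[lam]_t (chi t * f t)%:E = \int[lam]_(t in `[0%R, L]) (f t)%:E)%E.
Proof.
rewrite [RHS]integral_mkcond; apply: eq_integral => t _.
rewrite patchE /chi indicE; case: (_ \in _) => /=; first by rewrite mul1r.
by rewrite mul0r.
Qed.

Lemma integral_chi1 : (\int[lam]_t (chi t)%:E = L%:E)%E.
Proof.
under eq_integral do rewrite -[chi _]mulr1.
rewrite integral_chi integral_cst //= mul1e lebesgue_measure_itv /= lte_fin L0.
by rewrite -EFinB subr0.
Qed.

Lemma measurable_line :
  measurable_fun [set: BRn R n * R]
    ((fun z : BRn R n * R => (z.1 : Rn) - z.2 *: e) : _ -> BRn R n).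
Proof.
apply: measurable_fun_Rn => // j.
rewrite [X in measurable_fun _ X](_ : _ =
    (fun z : BRn R n * R => (z.1 : Rn) 0 j - z.2 * e 0 j)).
  apply: measurable_funB.
    exact: (measurableT_comp (f := fun x : BRn R n => (x : Rn) 0 j)
             (measurable_coord j) measurable_fst).
  by apply: measurable_funM => //; exact: measurable_snd.
by apply/funext => z; rewrite !mxE.
Qed.

Lemma measurable_chi_snd :
  measurable_fun [set: BRn R n * R] (fun z : BRn R n * R => chi z.2).
Proof.
apply: (measurableT_comp (f := chi)); first exact: measurable_chi.
exact: measurable_snd.
Qed.

Lemma measurable_comp_line (k : Rn -> R) :
  measurable_fun setT (k : BRn R n -> R) ->
  measurable_fun [set: BRn R n * R]
    (fun z : BRn R n * R => chi z.2 * k ((z.1 : Rn) - z.2 *: e)).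
Proof.
move=> mk; apply: measurable_funM.
  exact: measurable_chi_snd.
exact: (measurableT_comp (f := (k : BRn R n -> R)) mk measurable_line).
Qed.

(** After exchanging the integrals, the inner one does not depend on t by translation invariance,
    and [chi] integrates to L. *)
Lemma tonelli_line (k : Rn -> R) :
  measurable_fun setT (k : BRn R n -> R) -> (forall x, 0 <= k x) ->
  (\int[mu]_x \int[lam]_t (chi t * k ((x : Rn) - t *: e)%R)%:E
    = L%:E * \int[mu]_x (k x)%:E)%E.
Proof.
move=> mk k0.
transitivity (\int[sigma_finite_leb]_x \int[lam]_t
    (chi t * k ((x : Rn) - t *: e)%R)%:E)%E => //.
pose f (z : BRn R n * R) := (chi z.2 * k ((z.1 : Rn) - z.2 *: e))%:E.
rewrite (@fubini_tonelli _ _ _ _ _ sigma_finite_leb lam f); last 2 first.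
- by apply/measurable_EFinP; exact: measurable_comp_line.
- by move=> z; rewrite lee_fin mulr_ge0 ?chi_ge0.
transitivity (\int[lam]_t ((\int[mu]_x (k x)%:E) * (chi t)%:E))%E.
  apply: eq_integral => t _.
  rewrite -(@ge0_integral_shift _ _ _ leb (- (t *: e)) (fun x => (k x)%:E)) //; last first.
    exact/measurable_EFinP.
  rewrite muleC -ge0_integralZl //=.
  - apply/measurable_EFinP.
    exact: (measurableT_comp (f := (k : BRn R n -> R)) mk (measurable_shift _)).
  - by move=> x _; rewrite lee_fin.
  - by rewrite lee_fin chi_ge0.
rewrite ge0_integralZl //.
- by rewrite integral_chi1 muleC.
- by apply/measurable_EFinP; exact: measurable_chi.
- by move=> t _; rewrite lee_fin chi_ge0.
- by apply: integral_ge0 => x _; rewrite lee_fin.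
Qed.

Lemma integrable_comp_line (k : Rn -> R) :
  mu.-integrable setT (fun x : BRn R n => (k x)%:E) ->
  (sigma_finite_leb \x lam)%E.-integrable setT
    (fun z : BRn R n * R => (chi z.2 * k ((z.1 : Rn) - z.2 *: e))%:E).
Proof.
move=> /integrableP[mk ik].
have {}mk : measurable_fun setT (k : BRn R n -> R) by apply/measurable_EFinP.
apply/integrable12ltyP.
  by apply/measurable_EFinP; exact: measurable_comp_line.
rewrite (_ : (\int[_]_x _)%E =
    (\int[mu]_x \int[lam]_t (chi t * `|k ((x : Rn) - t *: e)%R|)%:E)%E); last first.
  apply: eq_integral => x _; apply: eq_integral => t _ /=.
  by rewrite normrM ger0_norm ?chi_ge0.
rewrite (@tonelli_line (fun x => `|k x|)) //; last exact: measurableT_comp.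
by rewrite lte_mul_pinfty ?lee_fin ?ltW.
Qed.

(** The function of [integrable_comp_line] after the substitution of x + t e for x. Fubini is
    applied on both sides of this substitution, so each form needs its own integrability. *)
Lemma integrable_chi_mul (k : Rn -> R) :
  mu.-integrable setT (fun x : BRn R n => (k x)%:E) ->
  (sigma_finite_leb \x lam)%E.-integrable setT
    (fun z : BRn R n * R => (chi z.2 * k z.1)%:E).
Proof.
move=> /integrableP[mk ik].
have {}mk : measurable_fun setT (k : BRn R n -> R) by apply/measurable_EFinP.
apply/integrable12ltyP.
  apply/measurable_EFinP; apply: measurable_funM.
    exact: measurable_chi_snd.
  exact: (measurableT_comp (f := (k : BRn R n -> R)) mk measurable_fst).
rewrite (_ : (\int[_]_x _)%E = (\int[mu]_x (L%:E * `|k x|%:E))%E); last first.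
  apply: eq_integral => x _ /=; rewrite -integral_chi1 muleC -ge0_integralZl //.
  - by apply: eq_integral => t _; rewrite /= normrM ger0_norm ?chi_ge0 // muleC.
  - by apply/measurable_EFinP; exact: measurable_chi.
  - by move=> t _; rewrite lee_fin chi_ge0.
rewrite ge0_integralZl //; first by rewrite lte_mul_pinfty ?lee_fin ?ltW.
- by apply/measurable_EFinP; exact: measurableT_comp.
- by rewrite lee_fin ltW.
Qed.

End Lines.

(** * Differentiation and integration along a coordinate direction *)

Section Antiderivative.
Variables (R : realType) (n : nat) (mu : {measure set (BRn R n) -> \bar R}).
Hypothesis leb : is_lebesgue mu.
Variables (i : 'I_n) (L : R).
Hypothesis L0 : 0 < L.
Notation Rn := 'rV[R]_n.
Notation e := (ebasis R i).
Notation lam := (@lebesgue_measure R).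

Lemma continuous_line (y : Rn) : continuous (fun t : R => y + t *: e).
Proof.
move=> t; apply: cvgD; first exact: cvg_cst.
by apply: cvgZr_tmp; exact: cvg_id.
Qed.

(** The difference quotient of the restriction to a line is the directional one; derivability and
    the derivative are both read off from this. *)
Lemma line_quotientE (phi : Rn -> R) (y : Rn) (t : R) :
  (fun h : R => h^-1 *: (phi (y + (h + t) *: e) - phi (y + t *: e))) =
  (fun h : R => h^-1 *: ((phi \o shift (y + t *: e)) (h *: e) - phi (y + t *: e))).
Proof.
apply/funext => h /=; congr (_ *: (phi _ - _)).
by rewrite scalerDl addrCA.
Qed.

Lemma derive1_line (phi : Rn -> R) (y : Rn) (t : R) :
  derive1 (fun t => phi (y + t *: e)) t = 'D_e phi (y + t *: e).
Proof. by rewrite /derive1 line_quotientE. Qed.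

Lemma derivable_line (phi : Rn -> R) (y : Rn) (t : R) :
  derivable phi (y + t *: e) e -> derivable (fun t : R => phi (y + t *: e)) t 1.
Proof.
rewrite /derivable -line_quotientE.
set f := (X in cvg (X @ _) -> _); set g := (X in _ -> cvg (X @ _)).
suff -> : f = g by [].
by apply/funext => h; rewrite /f /g /= [h *: 1]mulr1.
Qed.

Lemma FTC_line (phi : Rn -> R) (y : Rn) :
  (forall x, derivable phi x e) -> continuous (fun x => 'D_e phi x) ->
  (\int[lam]_t (chi L t * 'D_e phi (y + t *: e)%R)%:E
   = (phi (y + L *: e)%R - phi y)%:E)%E.
Proof.
move=> dphi cphi; rewrite integral_chi.
have cline : continuous (fun t : R => phi (y + t *: e)).
  move=> t; apply: differentiable_continuous; apply/derivable1_diffP.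
  exact: derivable_line.
rewrite (@continuous_FTC2 _ _ (fun t => phi (y + t *: e))) //.
- by rewrite scale0r addr0.
- apply: continuous_subspaceT => t.
  apply: (@continuous_comp _ _ _ (fun t : R => y + t *: e) (fun x => 'D_e phi x)).
    exact: continuous_line.
  exact: cphi.
- split.
  + by move=> t _; exact: derivable_line.
  + exact: cvg_at_right_filter (cline _).
  + exact: cvg_at_left_filter (cline _).
- by move=> t _; exact: derive1_line.
Qed.

(* With [k] extended by zero outside a domain of width less than [L], this is the
   antiderivative of [k] in the direction [e] that vanishes far upstream. *)
Definition line_int (k : Rn -> R) (x : Rn) : R :=
  fine (\int[lam]_t (chi L t * k (x - t *: e)%R)%:E)%E.

Lemma measurable_line_slice (k : Rn -> R) (x : Rn) :
  measurable_fun setT (k : BRn R n -> R) ->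
  measurable_fun [set: R] (fun t : R => chi L t * k (x - t *: e)).
Proof.
move=> mk.
exact: (measurableT_comp (measurable_comp_line i L mk) (pair1_measurable (x : BRn R n))).
Qed.

(** Hölder's inequality in t, with the integrand written as chi times (chi k): the first factor
    contributes L^(1/r), which becomes L^(s/r) at the power s. *)
Lemma line_int_pow (k : Rn -> R) (s r : R) (x : Rn) :
  0 < s -> 0 < r -> r^-1 + s^-1 = 1 ->
  measurable_fun setT (k : BRn R n -> R) ->
  ((`|line_int k x| `^ s)%:E <=
   (L `^ (s / r))%:E * \int[lam]_t (chi L t * `|k (x - t *: e)%R| `^ s)%:E)%E.
Proof.
move=> s0 r0 rs mk.
have mks : measurable_fun setT ((fun x => `|k x| `^ s) : BRn R n -> R).
  exact: measurable_norm_powR.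
have mch : measurable_fun [set: R] (chi L) by exact: measurable_chi.
set J := (\int[lam]_t _)%E.
(* When [J] is infinite so is the right side, because L^(s/r) > 0, while the left side is a real
   number whatever [fine] returns. *)
have [Joo|Jfin] := eqVneq J +oo%E.
  by rewrite Joo gt0_muley ?leey // lte_fin powR_gt0 //.
have J0 : (0 <= J)%E.
  by apply: integral_ge0 => t _; rewrite lee_fin mulr_ge0 ?chi_ge0 ?powR_ge0.
have Jlt : (J < +oo)%E by rewrite ltey.
have kE t : `|chi L t * k (x - t *: e)| `^ s = chi L t * `|k (x - t *: e)| `^ s.
  by rewrite normrM powRM // ger0_norm ?chi_ge0 // chi_powR // gt_eqF.
have cE t : `|chi L t| `^ r = chi L t.
  by rewrite ger0_norm ?chi_ge0 // chi_powR // gt_eqF.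
have ick : lam.-integrable setT (fun t => (`|chi L t * k (x - t *: e)| `^ s)%:E).
  apply/integrableP; split.
    by apply/measurable_EFinP; apply: measurable_norm_powR; exact: measurable_line_slice.
  apply: le_lt_trans Jlt; rewrite le_eqVlt; apply/orP; left; apply/eqP.
  by apply: eq_integral => t _; rewrite kE gee0_abs // lee_fin mulr_ge0 ?chi_ge0 ?powR_ge0.
have ich : lam.-integrable setT (fun t => (`|chi L t| `^ r)%:E).
  apply/integrableP; split.
    by apply/measurable_EFinP; exact: measurable_norm_powR.
  apply: (@le_lt_trans _ _ (\int[lam]_t (chi L t)%:E)%E).
    by apply: ge0_le_integral => //;
      [exact/measurable_EFinP/measurableT_comp/measurable_norm_powR
      |exact/measurable_EFinP
      |move=> t _; rewrite cE gee0_abs // lee_fin chi_ge0].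
  by rewrite integral_chi1 // ltry.
have ip : lam.-integrable setT (fun t => (chi L t * (chi L t * k (x - t *: e)))%:E).
  by apply: (hoelder_integrable measurableT r0 s0 rs) => //; exact: measurable_line_slice.
have pE t : chi L t * (chi L t * k (x - t *: e)) = chi L t * k (x - t *: e).
  by rewrite /chi indicE; case: (_ \in _); rewrite ?mul1r ?mul0r.
have h : \int[lam]_t (`|chi L t| * `|chi L t * k (x - t *: e)|) <=
    (\int[lam]_t (`|chi L t| `^ r)) `^ r^-1 *
    (\int[lam]_t (`|chi L t * k (x - t *: e)| `^ s)) `^ s^-1.
  by apply: (hoelder_Rintegral measurableT r0 s0 rs) => //; exact: measurable_line_slice.
have Ws : `|line_int k x| <= L `^ r^-1 * fine J `^ s^-1.
  apply: le_trans; last first.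
    apply: le_trans h _; rewrite le_eqVlt; apply/orP; left; apply/eqP; congr (_ `^ _ * _ `^ _).
      transitivity (fine (\int[lam]_t (chi L t)%:E)%E); last by rewrite integral_chi1.
      by rewrite /Rintegral; congr fine; apply: eq_integral => t _; rewrite cE.
    by rewrite /Rintegral; congr fine; apply: eq_integral => t _; rewrite kE.
  rewrite (_ : line_int k x = \int[lam]_t (chi L t * (chi L t * k (x - t *: e)))); last first.
    by rewrite /line_int /Rintegral; congr fine; apply: eq_integral => t _; rewrite pE.
  apply: le_trans (le_normr_Rintegral measurableT ip) _.
  by rewrite le_eqVlt; apply/orP; left; apply/eqP; apply: eq_Rintegral => t _; rewrite normrM.
have -> : J = (fine J)%:E by rewrite fineK // ge0_fin_numE.
rewrite -EFinM lee_fin.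
apply: (@le_trans _ _ ((L `^ r^-1 * fine J `^ s^-1) `^ s)).
  by apply: ge0_ler_powR; rewrite ?nnegrE ?mulr_ge0 ?powR_ge0 // ltW.
rewrite powRM ?powR_ge0 // -!powRrM mulVf ?gt_eqF // powRr1 ?fine_ge0 //.
by rewrite (mulrC s).
Qed.

End Antiderivative.

(** * Weak divergence of the line integral *)

Section DivergenceInverse.
Variables (R : realType) (n : nat) (mu : {measure set (BRn R n) -> \bar R}).
Hypothesis leb : is_lebesgue mu.
Variables (i : 'I_n) (L : R).
Hypothesis L0 : 0 < L.
Notation Rn := 'rV[R]_n.
Notation e := (ebasis R i).
Notation lam := (@lebesgue_measure R).
Notation smu := (sigma_finite_leb leb).

(** The compact set K is closed, so off K the function vanishes on a neighbourhood and its
    derivative is zero too. Continuity on K then bounds both. *)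
Lemma test_fun_deriv (Om : set Rn) (phi : Rn -> R) : test_fun Om phi ->
  [/\ continuous phi, forall x, derivable phi x e,
      continuous (fun x => 'D_e phi x),
      forall x, ~ Om x -> phi x = 0 /\ 'D_e phi x = 0 &
      exists M, forall x, `|phi x| <= M /\ `|'D_e phi x| <= M].
Proof.
move=> [sm [K [cK KOm phi0]]].
have [cphi dphi] := sm [::].
have [cD _] := sm [:: i]; rewrite /= in cD cphi dphi.
have clK : closed K by apply: compact_closed => //; exact: norm_hausdorff.
have D0 x : ~ K x -> 'D_e phi x = 0.
  move=> nKx; rewrite (@near_eq_derive _ _ _ _ (cst 0)) ?derive_cst //.
  have : nbhs x (~` K) by apply: open_nbhs_nbhs; split=> //; rewrite openC.
  by apply: filterS => y; exact: phi0.
have bnd (f : Rn -> R) : continuous f -> (forall x, ~ K x -> f x = 0) ->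
    exists M, forall x, `|f x| <= M.
  move=> cf f0.
  have /compact_bounded[M [_ bM]] : compact [set f x | x in K].
    by apply: continuous_compact => //; exact: continuous_subspaceT.
  exists (`|M| + 1) => x; have [Kx|nKx] := pselect (K x).
    by apply: bM; [rewrite ltr_pwDr // ler_norm|exists x].
  by rewrite f0 // normr0 addr_ge0.
split => // [x nOm|].
  have nK : ~ K x by move=> /KOm.
  by rewrite phi0 // D0.
have [M1 h1] := bnd _ cphi phi0; have [M2 h2] := bnd _ cD D0.
exists (Num.max M1 M2) => x; rewrite !le_max h1 h2 orbT; split => //.
Qed.

Lemma measurable_lineD :
  measurable_fun [set: BRn R n * R]
    ((fun z : BRn R n * R => (z.1 : Rn) + z.2 *: e) : _ -> BRn R n).
Proof.
apply: measurable_fun_Rn => // j.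
rewrite [X in measurable_fun _ X](_ : _ =
    (fun z : BRn R n * R => (z.1 : Rn) 0 j + z.2 * e 0 j)).
  apply: measurable_funD.
    exact: (measurableT_comp (f := fun x : BRn R n => (x : Rn) 0 j)
             (measurable_coord j) measurable_fst).
  by apply: measurable_funM => //; exact: measurable_snd.
by apply/funext => z; rewrite !mxE.
Qed.

Lemma measurable_line_int (k : Rn -> R) :
  mu.-integrable setT (fun x : BRn R n => (k x)%:E) ->
  measurable_fun setT (line_int i L k : BRn R n -> R).
Proof.
move=> ik; apply: (measurableT_comp (fine_measurable measurableT)).
exact: (measurable_fubini_F (integrable_comp_line leb i L0 ik)).
Qed.

(** Fubini and the translation by t e move the shift from k to the derivative of phi. The integral
    in t is then phi(x + L e) - phi(x), and the first value is zero because x + L e has left the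
    domain. *)
Lemma weak_div_line_int (Om : set Rn) (k phi : Rn -> R) :
  (forall x, Om x -> ~ Om (x + L *: e)) ->
  mu.-integrable setT (fun x : BRn R n => (k x)%:E) ->
  (forall x, ~ Om x -> k x = 0) -> test_fun Om phi ->
  (\int[mu]_x (line_int i L k x * 'D_e phi x)%:E = \int[mu]_x (- (k x * phi x))%:E)%E.
Proof.
move=> OmL ik k0 tphi.
have [cphi dphi cD phi0 [M bM]] := test_fun_deriv tphi.
have mk : measurable_fun setT (k : BRn R n -> R).
  by apply/measurable_EFinP; exact: measurable_int ik.
pose psi := fun x : Rn => 'D_e phi x.
have mpsi : measurable_fun setT (psi : BRn R n -> R).
  exact: continuous_measurable_Rn.
have M0 : 0 <= M by apply: le_trans (bM 0).1.
have psiM x : `|psi x| <= M by exact: (bM x).2.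
pose F2 (z : BRn R n * R) := (psi z.1 * (chi L z.2 * k ((z.1 : Rn) - z.2 *: e)))%:E.
pose F3 (z : BRn R n * R) := (psi ((z.1 : Rn) + z.2 *: e) * (chi L z.2 * k z.1))%:E.
have mF2 : measurable_fun setT F2.
  apply/measurable_EFinP/measurable_funM; last exact: measurable_comp_line.
  exact: (measurableT_comp (f := (psi : BRn R n -> R)) mpsi measurable_fst).
have iF2 : (smu \x lam)%E.-integrable setT F2.
  have := integrableZl measurableT M (integrable_comp_line leb i L0 ik).
  apply: le_integrable => //.
  move=> z _; rewrite /F2 abseM /= normrM lee_fin (ger0_norm M0).
  by rewrite ler_wpM2r.
have iF3 : (smu \x lam)%E.-integrable setT F3.
  have := integrableZl measurableT M (integrable_chi_mul leb L0 ik).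
  apply: le_integrable => //.
    apply/measurable_EFinP/measurable_funM.
      exact: (measurableT_comp (f := (psi : BRn R n -> R)) mpsi measurable_lineD).
    apply: measurable_funM; first exact: measurable_chi_snd.
    exact: (measurableT_comp (f := (k : BRn R n -> R)) mk measurable_fst).
  move=> z _; rewrite /F3 abseM /= normrM lee_fin (ger0_norm M0).
  by rewrite ler_wpM2r.
(* [line_int] is a [fine], faithful only where the slice in t is integrable; Fubini gives this for
   almost every x, which suffices under the integral. *)
transitivity (\int[smu]_x \int[lam]_t F2 (x, t))%E.
  apply: (@ae_eq_integral _ _ _ smu) => //.
  - apply/measurable_EFinP/measurable_funM => //.
    exact: measurable_line_int.
  - exact: (measurable_fubini_F iF2).
  - have := ae_integrable1 (integrable_comp_line leb i L0 ik).
    apply: filterS => x ix _; rewrite /F2 /=.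
    under eq_integral do rewrite EFinM.
    rewrite integralZl // mulrC EFinM; congr (_ * _)%E.
    rewrite /line_int fineK //.
    exact: (integrable_fin_num measurableT ix).
rewrite (Fubini iF2).
transitivity (\int[lam]_t \int[smu]_x F3 (x, t))%E.
  apply: eq_integral => t _.
  rewrite -[LHS](@integral_shift _ _ _ leb (t *: e)); last first.
    exact: (measurableT_comp mF2 (pair2_measurable (t : R))).
  by apply: eq_integral => x _; rewrite /F2 /F3 /= addrK.
rewrite -(Fubini iF3); apply: eq_integral => x _.
rewrite /F3 /=.
have [Ox|nOx] := pselect (Om x); last first.
  rewrite k0 // mul0r oppr0 integral0_eq // => t _.
  by rewrite mulr0 mulr0.
transitivity (\int[lam]_t ((k x)%:E * (chi L t * psi (x + t *: e)%R)%:E))%E.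
  by apply: eq_integral => t _; rewrite -EFinM; congr EFin; ring.
rewrite integralZl //.
  rewrite FTC_line // (phi0 (x + L *: e) (OmL _ Ox)).1 sub0r -EFinM.
  by rewrite mulrN.
have ichi : lam.-integrable setT (fun t => (chi L t)%:E).
  apply/integrableP; split; first by apply/measurable_EFinP; exact: measurable_chi.
  under eq_integral do rewrite gee0_abs ?lee_fin ?chi_ge0 //.
  by rewrite integral_chi1 // ltry.
have := integrableZl measurableT M ichi; apply: le_integrable => //.
- apply/measurable_EFinP/measurable_funM; first exact: measurable_chi.
  exact: (measurableT_comp (measurableT_comp (f := (psi : BRn R n -> R)) mpsi measurable_lineD)
    (pair1_measurable (x : BRn R n))).
- move=> t _; rewrite abseM /= normrM lee_fin mulrC ler_wpM2r //.
  by rewrite (ger0_norm M0).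
Qed.

End DivergenceInverse.

(** * Solving div v = g on a bounded open set *)

Section DivergenceSolve.
Variables (R : realType) (n : nat) (mu : {measure set (BRn R n) -> \bar R}).
Hypothesis leb : is_lebesgue mu.
Notation Rn := 'rV[R]_n.
Variable Om : set Rn.
Hypotheses (oOm : open Om) (bOm : bounded_set Om).

Lemma measurable_domain : measurable (Om : set (BRn R n)).
Proof. exact: open_measurable_Rn. Qed.

Lemma integrable_cst_domain (c : R) :
  mu.-integrable (Om : set (BRn R n)) (fun=> c%:E).
Proof.
apply/integrableP; split; first exact: measurable_cst.
rewrite integral_cst; last exact: measurable_domain.
by rewrite lte_mul_pinfty //; apply: bounded_lebesgue_lty => //; exact: measurable_domain.
Qed.

Lemma edotZ_ebasis (i : 'I_n) (a : R) (y : Rn) : edot (a *: ebasis R i) y = a * y 0 i.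
Proof.
rewrite /edot (bigD1 i) //= big1 ?addr0 => [|j ji]; rewrite !mxE ?eqxx ?mulr1 //.
by rewrite (negbTE ji) andbF mulr0 mul0r.
Qed.

Lemma enormZ_ebasis (i : 'I_n) (a : R) : enorm (a *: ebasis R i) = `|a|.
Proof.
by rewrite /enorm edotZ_ebasis !mxE !eqxx mulr1 -expr2 sqrtr_sqr.
Qed.

Lemma Lmem_integrable (s r : R) (g : Rn -> R) : 0 < s -> 0 < r -> r^-1 + s^-1 = 1 ->
  Lmem mu Om s g -> mu.-integrable (Om : set (BRn R n)) (fun x : BRn R n => (g x)%:E).
Proof.
move=> s0 r0 rs [mg ig].
under eq_fun do rewrite -[g _]mul1r.
apply: (hoelder_integrable measurable_domain r0 s0 rs) => //.
by under eq_fun do rewrite normr1 powR1; exact: integrable_cst_domain.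
Qed.

Lemma exists_exit_length (i : 'I_n) : exists2 L : R, 0 < L &
  forall x, Om x -> ~ Om (x + L *: ebasis R i).
Proof.
have [M [_ bM]] := bOm.
pose B := `|M| + 1.
have bB x : Om x -> `|x 0 i| <= B.
  move=> Ox; apply: le_trans (ler_coord_norm _ _) _.
  by apply: bM => //; rewrite /B ltr_pwDr // ler_norm.
have B0 : 0 < B by rewrite /B ltr_pwDr.
(* The i-th coordinate stays in [-B, B] on the domain, so any translation by more than 2B leaves
   it. *)
exists (2 * B + 1); first by rewrite addr_gt0 // mulr_gt0.
move=> x /bB + /bB; rewrite !mxE !eqxx mulr1 !ler_norml.
move=> /andP[h1 _] /andP[_ h2]; lra.
Qed.

(** This plays the role of the inf-sup condition for b. The exit length is also the norm bound:
    Hölder in t contributes L^(s/r), Tonelli another L, and s/r + 1 = s. *)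
Lemma divergence_right_inverse (s r : R) : (0 < n)%N ->
  0 < s -> 0 < r -> r^-1 + s^-1 = 1 ->
  exists2 L : R, 0 < L & forall g, Lmem mu Om s g ->
    exists2 v, Vmem mu Om s v g & Lnrm_vec mu Om s v <= L * Lnrm mu Om s g.
Proof.
move=> n0 s0 r0 rs; pose i := Ordinal n0.
have [L L0 OmL] := exists_exit_length i; exists L => // g Lg.
have [mg ig] := Lg; have mOm := measurable_domain.
pose k : Rn -> R := g \_ Om.
have k0 x : ~ Om x -> k x = 0 by move=> nOx; rewrite /k patchE memNset.
have kE x : Om x -> k x = g x by move=> Ox; rewrite /k patchE (mem_set Ox).
have mk : measurable_fun setT (k : BRn R n -> R).
  exact: (measurable_restrictT (g : BRn R n -> R) mOm).1 mg.
have ik : mu.-integrable setT (fun x : BRn R n => (k x)%:E).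
  have /(integrable_mkcond _ mOm) := Lmem_integrable s0 r0 rs Lg.
  by rewrite (restrict_EFin (g : BRn R n -> R)).
clearbody k.
have kpow : (\int[mu]_x (`|k x| `^ s)%:E = \int[mu]_(x in (Om : set (BRn R n))) (`|g x| `^ s)%:E)%E.
  rewrite [RHS]integral_mkcond; apply: eq_integral => x _; rewrite patchE.
  case: ifPn => [/set_mem /kE ->//|/negP nx].
  by rewrite k0 ?normr0 ?powR0 ?gt_eqF // => Ox; apply: nx; rewrite inE.
have gpow_lty : (\int[mu]_(x in (Om : set (BRn R n))) (`|g x| `^ s)%:E < +oo)%E.
  move: ig => /integrableP[_]; apply: le_lt_trans.
  rewrite le_eqVlt; apply/orP; left; apply/eqP; apply: eq_integral => x _.
  by rewrite gee0_abs // lee_fin powR_ge0.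
have gpow_ge0 : (0 <= \int[mu]_(x in (Om : set (BRn R n))) (`|g x| `^ s)%:E)%E.
  by apply: integral_ge0 => x _; rewrite lee_fin powR_ge0.
have mks : measurable_fun setT ((fun x => `|k x| `^ s) : BRn R n -> R).
  exact: measurable_norm_powR.
have mli := measurable_line_int leb i L0 ik.
have srE : s / r + 1 = s.
  have -> : r^-1 = 1 - s^-1 by rewrite -rs addrK.
  by rewrite mulrBr mulr1 divff ?gt_eqF // subrK.
have bound : (\int[mu]_(x in (Om : set (BRn R n))) (`|line_int i L k x| `^ s)%:E <=
    (L `^ s)%:E * \int[mu]_(x in (Om : set (BRn R n))) (`|g x| `^ s)%:E)%E.
  have mF : measurable_fun setT
      (fun x : BRn R n => \int[lebesgue_measure]_t
        (chi L t * `|k ((x : Rn) - t *: ebasis R i)%R| `^ s)%:E)%E.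
    apply: (measurable_fun_fubini_tonelli_F (m2 := @lebesgue_measure R)
      (fun z : BRn R n * R => (chi L z.2 * `|k ((z.1 : Rn) - z.2 *: ebasis R i)%R| `^ s)%:E)).
      apply/measurable_EFinP.
      exact: (@measurable_comp_line _ _ i L (fun x => `|k x| `^ s)).
    by move=> z; rewrite lee_fin mulr_ge0 ?chi_ge0 ?powR_ge0.
  have F0 (x : Rn) : (0 <=
      \int[lebesgue_measure]_t (chi L t * `|k (x - t *: ebasis R i)%R| `^ s)%:E)%E.
    by apply: integral_ge0 => t _; rewrite lee_fin mulr_ge0 ?chi_ge0 ?powR_ge0.
  apply: (@le_trans _ _ (\int[mu]_x (`|line_int i L k x| `^ s)%:E)%E).
    apply: ge0_subset_integral => //.
    by apply/measurable_EFinP; exact: measurable_norm_powR.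
  apply: (@le_trans _ _ (\int[mu]_x ((L `^ (s / r))%:E *
      \int[lebesgue_measure]_t (chi L t * `|k ((x : Rn) - t *: ebasis R i)%R| `^ s)%:E))%E).
    apply: ge0_le_integral => //.
    - by apply/measurable_EFinP; exact: measurable_norm_powR.
    - exact: measurable_funeM.
    - by move=> x _; exact: line_int_pow.
  rewrite ge0_integralZl //; last by rewrite lee_fin powR_ge0.
  rewrite (@tonelli_line _ _ _ leb i L L0 (fun x => `|k x| `^ s)) //.
  rewrite kpow muleA -EFinM (_ : L `^ (s / r) * L = L `^ s) //.
  by rewrite -{2}(powRr1 (ltW L0)) -powRD ?srE // gt_eqF ?implybT.
have norm_enorm x : `|enorm (line_int i L k x *: ebasis R i)| = `|line_int i L k x|.
  by rewrite enormZ_ebasis normr_id.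
exists (fun x => line_int i L k x *: ebasis R i).
  split => //.
  - split => [j|].
      rewrite [X in measurable_fun _ X](_ : _ =
        (fun x : BRn R n => line_int i L k x * ebasis R i 0 j)); last first.
        by apply/funext => x; rewrite mxE.
      by apply: measurable_funM => //; exact: measurable_funTS mli.
    under eq_fun do rewrite enormZ_ebasis.
    apply/integrableP; split.
      by apply/measurable_EFinP; apply: measurable_norm_powR; exact: measurable_funTS mli.
    under eq_integral do rewrite gee0_abs ?lee_fin ?powR_ge0 //.
    by apply: le_lt_trans bound _; rewrite lte_mul_pinfty // lee_fin powR_ge0.
  - move=> phi tphi.
    have [cphi _ _ phi0 [M bM]] := test_fun_deriv i tphi.
    have igp : mu.-integrable (Om : set (BRn R n)) (fun x : BRn R n => (g x * phi x)%:E).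
      have := integrableZl mOm M (Lmem_integrable s0 r0 rs Lg).
      apply: le_integrable => //.
        apply/measurable_EFinP/measurable_funM => //; apply: measurable_funTS.
        exact: continuous_measurable_Rn.
      move=> x _; rewrite abseM /= normrM lee_fin mulrC ler_wpM2r //.
      by apply: le_trans (bM x).1 _; exact: ler_norm.
    (* Both sides of the weak identity pass to the whole space: the derivative of [phi] vanishes off
       the domain, and so does [k]. *)
    transitivity (fine (\int[mu]_x (line_int i L k x * 'D_(ebasis R i) phi x)%:E)%E).
      rewrite /Rintegral [in LHS]integral_mkcond; congr fine; apply: eq_integral => x _.
      rewrite patchE; case: ifPn => [_|/negP nx].
        by rewrite edotZ_ebasis mxE.
      by rewrite (phi0 x _).2 ?mulr0 // => Ox; apply: nx; rewrite inE.
    rewrite (weak_div_line_int leb L0 OmL ik k0 tphi) -mulN1r -RintegralZl //.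
    rewrite /Rintegral [in RHS]integral_mkcond; congr fine; apply: eq_integral => x _.
    rewrite patchE; case: ifPn => [/set_mem /kE ->|/negP nx]; first by rewrite mulN1r.
    by rewrite k0 ?mul0r ?oppr0 // => Ox; apply: nx; rewrite inE.
rewrite /Lnrm_vec /Lnrm.
set G := \int[mu]_(x in _) (`|g x| `^ s).
have G0 : 0 <= G by apply: Rintegral_ge0 => x _; exact: powR_ge0.
have Ls0 : 0 <= L `^ s by exact: powR_ge0.
apply: (@le_trans _ _ ((L `^ s * G) `^ s^-1)); last first.
  rewrite powRM // -powRrM divff; last by rewrite gt_eqF.
  by rewrite powRr1 // ltW.
apply: ge0_ler_powR.
- by rewrite invr_ge0 ltW.
- by rewrite nnegrE; apply: Rintegral_ge0 => x _; exact: powR_ge0.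
- by rewrite nnegrE mulr_ge0.
under eq_Rintegral do rewrite norm_enorm.
rewrite -lee_fin EFinM /G /Rintegral !fineK //.
- by rewrite ge0_fin_numE.
- rewrite ge0_fin_numE; last by apply: integral_ge0 => x _; rewrite lee_fin powR_ge0.
  by apply: le_lt_trans bound _; rewrite lte_mul_pinfty // lee_fin powR_ge0.
Qed.

End DivergenceSolve.

(** * The scalar estimates *)

Section Scalar.
Variable R : realType.
Implicit Types a b x y p : R.

Lemma powR_le x y p : 0 <= p -> 0 <= x -> x <= y -> x `^ p <= y `^ p.
Proof.
move=> p0 x0 xy; apply: ge0_ler_powR => //; rewrite nnegrE //.
exact: le_trans xy.
Qed.

Lemma powRS x p : 1 < p -> 0 <= x -> x * x `^ (p - 1) = x `^ p.
Proof.
move=> p1 x0; have [->|nx] := eqVneq x 0.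
  by rewrite mul0r powR0 // gt_eqF // (lt_trans ltr01).
rewrite -{1}(powRr1 x0) -powRD ?nx ?implybT //.
by congr (_ `^ _); ring.
Qed.

(** Below 1 the smaller exponent dominates, above 1 the larger. With the exponents r - 1 and s - 1
    this absorbs the linear terms. *)
Lemma le_powR_add x a b : 0 <= a -> a <= 1 -> 1 <= b -> 0 <= x ->
  x <= x `^ a + x `^ b.
Proof.
move=> a0 a1 b1 x0; have [x1|x1] := leP x 1.
  rewrite -[leLHS]addr0 lerD ?powR_ge0 //.
  have [->|nx] := eqVneq x 0; first exact: powR_ge0.
  by rewrite -{1}(powRr1 x0); apply: ger_powR => //; rewrite lt_def nx x0.
rewrite -[leLHS]add0r lerD ?powR_ge0 //.
by rewrite -{1}(powRr1 x0); apply: ler_powR => //; exact: ltW.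
Qed.

(** The sum is at most three times the largest entry, whose power is one of the summands. *)
Lemma powR_add3_le x y z p : 0 <= p -> 0 <= x -> 0 <= y -> 0 <= z ->
  (x + y + z) `^ p <= 3 `^ p * (x `^ p + y `^ p + z `^ p).
Proof.
move=> p0 x0 y0 z0.
have key m : 0 <= m -> x <= m -> y <= m -> z <= m ->
    m `^ p <= x `^ p + y `^ p + z `^ p ->
    (x + y + z) `^ p <= 3 `^ p * (x `^ p + y `^ p + z `^ p).
  move=> m0 xm ym zm h; apply: (@le_trans _ _ ((3 * m) `^ p)).
    by apply: powR_le => //; [rewrite !addr_ge0|lra].
  by rewrite powRM // ler_wpM2l ?powR_ge0.
have [px py pz] : [/\ 0 <= x `^ p, 0 <= y `^ p & 0 <= z `^ p] by split; exact: powR_ge0.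
have [xy|yx] := leP x y; have [yz|zy] := leP y z; have [xz|zx] := leP x z.
- by apply: (key z) => //; lra.
- by apply: (key z) => //; lra.
- by apply: (key y) => //; lra.
- by apply: (key y) => //; lra.
- by apply: (key z) => //; lra.
- by apply: (key x) => //; lra.
- by apply: (key x) => //; lra.
- by apply: (key x) => //; lra.
Qed.

(** The l^p norm is at most the l^1 norm, because z^p <= z (x + y)^(p-1) for each entry z. It
    replaces the norm of V by the sum of its two parts. *)
Lemma addr_powR_inv_le x y p : 1 <= p -> 0 <= x -> 0 <= y ->
  (x `^ p + y `^ p) `^ p^-1 <= x + y.
Proof.
move=> p1 x0 y0; have p0 : 0 < p by exact: lt_le_trans p1.
have xy0 : 0 <= x + y by rewrite addr_ge0.
have E : (x + y) = ((x + y) `^ p) `^ p^-1 by rewrite -powRrM divff ?gt_eqF // powRr1.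
rewrite [leRHS]E; apply: powR_le; first by rewrite invr_ge0 ltW.
  by rewrite addr_ge0 ?powR_ge0.
have [->|px] := eqVneq x 0; first by rewrite powR0 ?gt_eqF // !add0r.
have {px} px : 0 < x by rewrite lt_def px.
have sp z : 0 <= z -> z <= x + y -> z `^ p <= z * (x + y) `^ (p - 1).
  move=> z0 zxy; have [p_gt1|] := ltP 1 p.
    by rewrite -powRS // ler_wpM2l // powR_le // subr_ge0.
  move=> pl1; have -> : p = 1 by apply/le_anti; rewrite p1 pl1.
  by rewrite subrr powRr0 powRr1 // mulr1.
have -> : (x + y) `^ p = x * (x + y) `^ (p - 1) + y * (x + y) `^ (p - 1).
  rewrite -mulrDl; have [p_gt1|pl1] := ltP 1 p; first by rewrite powRS.
  have -> : p = 1 by apply/le_anti; rewrite p1 pl1.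
  by rewrite subrr powRr0 powRr1 // mulr1.
by apply: lerD; apply: sp => //; lra.
Qed.

(* If [U > M] then every term on the right of the energy inequality is at most
   a multiple of [M * U `^ (s - 1)], which can be divided by [U `^ (s - 1)]. *)
Lemma energy_bound (s c C beta gamma U G P M : R) :
  2 < s -> 0 < c -> 0 <= C -> 0 <= beta -> 0 <= gamma -> 0 <= U -> 0 <= G ->
  0 <= M -> beta <= M `^ (s - 1) -> gamma <= M `^ (s - 1) -> gamma <= M ->
  G <= gamma -> P <= C * (U + U `^ (s - 1) + beta) ->
  c * U `^ s <= beta * (U + G) + G * P ->
  U <= (1 + (2 + 3 * C) / c) * M.
Proof.
move=> s2 c0 C0 b0 g0 U0 G0 M0 bM gM gM1 Gg PC en.
have k0 : 0 <= (2 + 3 * C) / c by rewrite divr_ge0 ?(ltW c0) // addr_ge0 // mulr_ge0.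
have [UM|MU] := leP U M.
  by apply: (le_trans UM); rewrite mulrDl mul1r lerDl mulr_ge0.
have Up : 0 < U by exact: le_lt_trans MU.
pose X := M * U `^ (s - 1).
have Us : 0 < U `^ (s - 1) by exact: powR_gt0.
have s1 : 1 < s by lra.
have s11 : 1 < s - 1 by lra.
have Usp : U `^ (s - 1) = U * U `^ (s - 1 - 1) by rewrite powRS.
(* One factor M is kept and the remaining power, of exponent s - 2 > 0, is enlarged from M to U. *)
have MsU : M `^ (s - 1) <= M * U `^ (s - 1 - 1).
  rewrite -powRS //; apply: ler_wpM2l => //; apply: powR_le => //; lra.
have t1 : M `^ (s - 1) * U <= X.
  rewrite /X Usp; apply: (le_trans (ler_wpM2r U0 MsU)).
  by rewrite le_eqVlt; apply/orP; left; apply/eqP; ring.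
have t2 : M `^ (s - 1) * M <= X.
  by apply: le_trans t1; rewrite ler_wpM2l ?powR_ge0 // ltW.
have bU : beta * U <= X by apply: le_trans t1; rewrite ler_wpM2r.
have bG : beta * G <= X.
  apply: le_trans t2; apply: ler_pM => //; exact: le_trans gM1.
have gU : gamma * U <= X by apply: le_trans t1; rewrite ler_wpM2r.
have gUs : gamma * U `^ (s - 1) <= X by rewrite /X ler_wpM2r // ltW.
have gb : gamma * beta <= X.
  by apply: le_trans t2; rewrite mulrC; apply: ler_pM.
have S0 : 0 <= U + U `^ (s - 1) + beta by rewrite !addr_ge0 // ltW.
have GP : G * P <= C * (3 * X).
  apply: (@le_trans _ _ (gamma * (C * (U + U `^ (s - 1) + beta)))).
    apply: (@le_trans _ _ (G * (C * (U + U `^ (s - 1) + beta)))).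
      exact: ler_wpM2l.
    by rewrite ler_wpM2r // mulr_ge0.
  rewrite mulrCA; apply: ler_wpM2l => //; lra.
have : c * U * U `^ (s - 1) <= (2 + 3 * C) * M * U `^ (s - 1).
  rewrite -mulrA powRS //; apply: (le_trans en).
  have -> : (2 + 3 * C) * M * U `^ (s - 1) = (X + X) + C * (3 * X) by rewrite /X; ring.
  by rewrite mulrDr; apply: lerD => //; apply: lerD.
rewrite ler_pM2r // => h.
have : U <= (2 + 3 * C) / c * M.
  by rewrite mulrAC ler_pdivlMr // mulrC.
by move=> h2; rewrite mulrDl mul1r; apply: (le_trans h2); rewrite lerDr.
Qed.

End Scalar.

(** * Conjugate exponents and elimination of U from the pressure bound *)

Section ScalarConclusion.
Variables (R : realType) (s : R).
Hypothesis s2 : 2 < s.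
Notation r := (s / (s - 1)).

Lemma sub1_neq0 : s - 1 != 0.
Proof. by rewrite subr_eq0 gt_eqF // (lt_trans _ s2) // ltr1n. Qed.

Lemma conj_sub1 : (r - 1) * (s - 1) = 1.
Proof. by rewrite mulrBl mul1r divfK ?sub1_neq0 // opprB addrC subrK. Qed.

Lemma conj_sub1_bounds : 0 < r - 1 /\ r - 1 <= 1.
Proof.
have E : r - 1 = (s - 1)^-1.
  by apply: (mulIf sub1_neq0); rewrite conj_sub1 mulVf // sub1_neq0.
have := s2; rewrite E => h; split; first by rewrite invr_gt0; lra.
by rewrite invf_le1; lra.
Qed.

(** Since (r - 1)(s - 1) = 1, raising the bound on U to the power s - 1 gives a multiple of beta +
    gamma + gamma^(s-1). The middle term is at most gamma^(r-1) + gamma^(s-1), whence the factor 2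
    in front of S. *)
Lemma pressure_bound (C2 C3 beta gamma U P : R) :
  0 <= C2 -> 0 <= C3 -> 0 <= beta -> 0 <= gamma -> 0 <= U ->
  U <= C3 * (beta `^ (r - 1) + gamma `^ (r - 1) + gamma) ->
  P <= C2 * (U + U `^ (s - 1) + beta) ->
  let S := gamma `^ (r - 1) + gamma `^ (s - 1) + beta `^ (r - 1) + beta in
  [/\ U <= 2 * C3 * S, gamma <= S &
      P <= C2 * (2 * C3 + (3 * C3) `^ (s - 1) * 2 + 1) * S].
Proof.
move=> C20 C30 b0 g0 U0 UM PU S; have s2' := s2.
have [r0 r1] := conj_sub1_bounds.
have s10 : 0 <= s - 1 by lra.
have gS : gamma <= gamma `^ (r - 1) + gamma `^ (s - 1).
  by apply: le_powR_add => //; [exact: ltW|lra].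
have pb : 0 <= beta `^ (r - 1) by exact: powR_ge0.
have pg : 0 <= gamma `^ (r - 1) by exact: powR_ge0.
have pgs : 0 <= gamma `^ (s - 1) by exact: powR_ge0.
set M := beta `^ (r - 1) + gamma `^ (r - 1) + gamma in UM.
have M0 : 0 <= M by rewrite /M !addr_ge0.
have MS : M <= 2 * S by rewrite /M /S; lra.
have US : U <= 2 * C3 * S.
  by apply: (le_trans UM); rewrite (mulrC 2) -mulrA ler_wpM2l.
have S0 : 0 <= S by rewrite /S !addr_ge0.
split => //; first by rewrite /S; lra.
have Ms : M `^ (s - 1) <= 3 `^ (s - 1) * (2 * S).
  apply: le_trans (powR_add3_le s10 pb pg g0) _.
  rewrite -!powRrM conj_sub1 !powRr1 //; apply: ler_wpM2l; first exact: powR_ge0.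
  by rewrite /S; lra.
have Us : U `^ (s - 1) <= (3 * C3) `^ (s - 1) * 2 * S.
  apply: (@le_trans _ _ ((C3 * M) `^ (s - 1))); first exact: powR_le.
  rewrite powRM // powRM // (mulrC (3 `^ _)) -!mulrA ler_wpM2l ?powR_ge0 //.
apply: (le_trans PU); rewrite -mulrA; apply: ler_wpM2l => //.
rewrite [leRHS]mulrDl mul1r [X in _ <= X + _]mulrDl.
apply: lerD; first exact: (lerD US Us).
by rewrite /S; lra.
Qed.

End ScalarConclusion.

(** * Euclidean norm *)

Section Euclid.
Variables (R : realType) (n : nat).
Notation Rn := 'rV[R]_n.
Implicit Types x y z : Rn.

Lemma edot_ge0 x : 0 <= edot x x.
Proof. by apply: sumr_ge0 => i _; rewrite -expr2 sqr_ge0. Qed.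

Lemma enorm_ge0 x : 0 <= enorm x.
Proof. exact: sqrtr_ge0. Qed.

Lemma enorm_sqr x : enorm x ^+ 2 = edot x x.
Proof. by rewrite sqr_sqrtr // edot_ge0. Qed.

Lemma edotC x y : edot x y = edot y x.
Proof. by apply: eq_bigr => i _; rewrite mulrC. Qed.

Lemma edotDl x y z : edot (x + y) z = edot x z + edot y z.
Proof.
by rewrite /edot -big_split; apply: eq_bigr => i _; rewrite mxE mulrDl.
Qed.

Lemma edotZl a x y : edot (a *: x) y = a * edot x y.
Proof. by rewrite /edot mulr_sumr; apply: eq_bigr => i _; rewrite mxE mulrA. Qed.

Lemma edot0l y : edot 0 y = 0.
Proof. by rewrite /edot big1 // => i _; rewrite mxE mul0r. Qed.

Lemma enorm0 : enorm (0 : Rn) = 0.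
Proof. by rewrite /enorm edot0l sqrtr0. Qed.

Lemma enormZ a x : enorm (a *: x) = `|a| * enorm x.
Proof.
by rewrite /enorm edotZl edotC edotZl mulrA -expr2 sqrtrM ?sqr_ge0 // sqrtr_sqr.
Qed.

Lemma norm_coord_le_enorm x i : `|x 0 i| <= enorm x.
Proof.
rewrite -sqrtr_sqr /enorm; apply: ler_wsqrtr.
rewrite /edot (bigD1 i) //= -expr2 lerDl.
by apply: sumr_ge0 => j _; rewrite -expr2 sqr_ge0.
Qed.

Lemma Cauchy_Schwarz x y : `|edot x y| <= enorm x * enorm y.
Proof.
rewrite -sqrtrM ?edot_ge0 // -sqrtr_sqr; apply: ler_wsqrtr.
have [y0|ny0] := eqVneq (edot y y) 0.
  have -> : y = 0.
    apply/rowP => i; apply/eqP; rewrite mxE -normr_le0.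
    by apply: le_trans (norm_coord_le_enorm y i) _; rewrite /enorm y0 sqrtr0.
  by rewrite edotC edot0l expr0n mulr_ge0 ?edot_ge0.
have yy : 0 < edot y y by rewrite lt_def ny0 edot_ge0.
(* This vector is y.y times the component of x orthogonal to y; its squared length is y.y times the
   Gram determinant of x and y. *)
have := edot_ge0 (edot y y *: x + (- edot x y) *: y).
rewrite edotDl !edotZl (edotC x (_ + _)) (edotC y (_ + _)) !edotDl !edotZl (edotC y x).
have -> : edot y y * (edot y y * edot x x + - edot x y * edot x y) +
   - edot x y * (edot y y * edot x y + - edot x y * edot y y) =
   edot y y * (edot x x * edot y y - edot x y ^+ 2) by ring.
by rewrite pmulr_rge0 // subr_ge0.
Qed.

Lemma enormD x y : enorm (x + y) <= enorm x + enorm y.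
Proof.
rewrite -(ler_pXn2r (n := 2)) // ?nnegrE ?addr_ge0 ?enorm_ge0 //.
rewrite enorm_sqr edotDl edotC edotDl (edotC y (x + y)) edotDl (edotC y x) -!enorm_sqr.
have := le_trans (ler_norm _) (Cauchy_Schwarz x y).
by rewrite sqrrD mulr2n; lra.
Qed.

(** Links the Euclidean norm of the hypotheses on F to the sup norm that defines the topology. *)
Lemma enorm_le_mxnorm x : enorm x <= Num.sqrt n%:R * `|x|.
Proof.
rewrite -[X in _ * X]ger0_norm // -sqrtr_sqr -sqrtrM // /enorm; apply: ler_wsqrtr.
rewrite /edot -[n in n%:R]card_ord -sum1_card natr_sum mulr_suml.
apply: ler_sum => i _; rewrite mul1r -expr2 -(real_normK (num_real (x 0 i))).
by rewrite ler_pXn2r ?nnegrE // ler_coord_norm.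
Qed.

Lemma measurable_edot (D : set Rn) (v w : Rn -> Rn) :
  (forall i, measurable_fun (D : set (BRn R n)) (fun x : BRn R n => v x 0 i)) ->
  (forall i, measurable_fun (D : set (BRn R n)) (fun x : BRn R n => w x 0 i)) ->
  measurable_fun (D : set (BRn R n)) (fun x : BRn R n => edot (v x) (w x)).
Proof.
by move=> mv mw; apply: measurable_sum => i; exact: measurable_funM.
Qed.

Lemma measurable_enorm (D : set Rn) (v : Rn -> Rn) :
  (forall i, measurable_fun (D : set (BRn R n)) (fun x : BRn R n => v x 0 i)) ->
  measurable_fun (D : set (BRn R n)) (fun x : BRn R n => enorm (v x)).
Proof.
move=> mv.
rewrite [X in measurable_fun _ X](_ : _ =
    (fun x : BRn R n => `|edot (v x) (v x)| `^ 2^-1)).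
  by apply: measurable_norm_powR; exact: measurable_edot.
by apply/funext => x; rewrite ger0_norm ?edot_ge0 // powR12_sqrt // edot_ge0.
Qed.

End Euclid.

(** * Growth and continuity of F *)

Section LocallyLipschitz.
Variables (R : realType) (n : nat) (s c1 : R) (Fn : 'rV[R]_n -> 'rV[R]_n).
Hypotheses (s2 : 2 < s) (c10 : 0 < c1) (Fn0 : Fn 0 = 0).
Hypothesis lipF : forall x y, enorm (Fn x - Fn y)
  <= c1 * (1 + enorm x `^ (s - 2) + enorm y `^ (s - 2)) * enorm (x - y).

(** The Lipschitz condition at y = 0, where 0^(s-2) vanishes because s > 2. *)
Lemma growth_bound x : enorm (Fn x) <= c1 * (enorm x + enorm x `^ (s - 1)).
Proof.
have s2' := s2; have := lipF x 0; rewrite Fn0 !subr0 enorm0 (powR0 (x := s - 2)); last first.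
  by rewrite gt_eqF // subr_gt0.
rewrite addr0 -mulrA mulrDl mul1r [X in _ + X]mulrC.
suff -> : enorm x * enorm x `^ (s - 2) = enorm x `^ (s - 1) by [].
have -> : s - 2 = (s - 1) - 1 by ring.
by rewrite powRS // ?enorm_ge0 //; lra.
Qed.

(** Serves to make F(u) measurable. Near x the norm of y is at most that of x plus 1, which freezes
    the Lipschitz factor. *)
Lemma continuous_coord_Fn i : continuous (fun x => Fn x 0 i).
Proof.
have s2' := s2; move=> x; apply/(@cvgrPdist_le _ _ _ (nbhs x) (nbhs_filter x)) => /= eps eps0.
pose K := c1 * (1 + enorm x `^ (s - 2) + (enorm x + 1) `^ (s - 2)) * Num.sqrt n%:R.
have sn0 : 0 <= Num.sqrt n%:R :> R by exact: sqrtr_ge0.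
have K0 : 0 <= K by rewrite !mulr_ge0 ?addr_ge0 ?powR_ge0 // ltW.
(* The second entry forces [enorm (x - y) <= 1], so that [K] applies to this y; the first then gives
   [eps]. Adding 1 keeps the denominators positive. *)
pose d := Num.min (eps / (K + 1)) (1 / (Num.sqrt n%:R + 1)).
have d0 : 0 < d by rewrite lt_min !divr_gt0 // ltr_wpDl.
apply/nbhs_ballP; exists d => //= y.
rewrite -ball_normE /= lt_min => /andP[/ltW h1 /ltW h2].
have e1 : enorm (x - y) <= 1.
  apply: le_trans (enorm_le_mxnorm _) _.
  apply: (@le_trans _ _ ((Num.sqrt n%:R + 1) * `|x - y|)).
    by rewrite ler_wpM2r // lerDl.
  by rewrite mulrC -ler_pdivlMr // ltr_wpDl.
have ey : enorm y <= enorm x + 1.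
  have -> : y = x + (-1) *: (x - y) by rewrite scaleN1r opprB addrC subrK.
  by apply: le_trans (enormD _ _) _; rewrite enormZ normrN1 mul1r lerD2l.
have -> : Fn x 0 i - Fn y 0 i = (Fn x - Fn y) 0 i by rewrite !mxE.
apply: le_trans (norm_coord_le_enorm _ _) _; apply: le_trans (lipF _ _) _.
apply: (@le_trans _ _ (K * `|x - y|)).
  rewrite -[leRHS]mulrA; apply: ler_pM; rewrite ?enorm_ge0 //.
  - by rewrite mulr_ge0 ?addr_ge0 ?powR_ge0 // ltW.
  - rewrite ler_pM2l // lerD2l; apply: powR_le => //; rewrite ?enorm_ge0 //; lra.
  - exact: enorm_le_mxnorm.
apply: (@le_trans _ _ ((K + 1) * `|x - y|)).
  by rewrite ler_wpM2r // lerDl.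
by rewrite mulrC -ler_pdivlMr // ltr_wpDl.
Qed.

End LocallyLipschitz.

(** * Dual norms *)

Section Spaces.
Variables (R : realType) (n : nat) (mu : {measure set (BRn R n) -> \bar R}).
Hypothesis leb : is_lebesgue mu.
Notation Rn := 'rV[R]_n.
Variable Om : set Rn.
Hypotheses (n0 : (0 < n)%N) (oOm : open Om) (bOm : bounded_set Om).
Variables s r : R.
Hypotheses (s0 : 0 < s) (r0 : 0 < r) (rs : r^-1 + s^-1 = 1).

Let mOm : measurable (Om : set (BRn R n)).
Proof. exact: measurable_domain. Qed.

Lemma Lnrm_ge0 (p : R) (f : Rn -> R) : 0 <= Lnrm mu Om p f.
Proof. exact: powR_ge0. Qed.

Lemma Vnrm_ge0 v g : 0 <= Vnrm mu Om s v g.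
Proof. exact: powR_ge0. Qed.

Lemma Lmem0 (p : R) : 0 < p -> Lmem mu Om p (fun=> 0).
Proof.
move=> p0; split; first exact: measurable_cst.
by under eq_fun do rewrite normr0 powR0 ?gt_eqF //; exact: integrable_cst_domain.
Qed.

Lemma Lnrm0 (p : R) : 0 < p -> Lnrm mu Om p (fun=> 0) = 0.
Proof.
move=> p0; rewrite /Lnrm; under eq_Rintegral do rewrite normr0 powR0 ?gt_eqF //.
by rewrite Rintegral_cst // mul0r powR0 // invr_eq0 gt_eqF.
Qed.

Lemma Vmem0 : Vmem mu Om s (fun=> 0) (fun=> 0).
Proof.
split; first split.
- by move=> i; exact: measurable_cst.
- by under eq_fun do rewrite enorm0 powR0 ?gt_eqF //; exact: integrable_cst_domain.
- exact: Lmem0.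
- move=> phi _; under eq_Rintegral do rewrite edot0l.
  under [in RHS]eq_Rintegral do rewrite mul0r.
  by rewrite Rintegral_cst // mul0r oppr0.
Qed.

Lemma Vnrm0 : Vnrm mu Om s (fun=> 0) (fun=> 0) = 0.
Proof.
rewrite /Vnrm /Lnrm_vec enorm0 Lnrm0 // powR0 ?gt_eqF // addr0.
by rewrite powR0 // invr_eq0 gt_eqF.
Qed.

Lemma LmemZ (p a : R) f : 0 < p -> Lmem mu Om p f -> Lmem mu Om p (fun x => a * f x).
Proof.
move=> p0 [mf ifp]; split; first exact: measurable_funM.
under eq_fun do rewrite normrM powRM // EFinM.
exact: integrableZl.
Qed.

Lemma LnrmZ (p a : R) f : 0 < p -> Lmem mu Om p f ->
  Lnrm mu Om p (fun x => a * f x) = `|a| * Lnrm mu Om p f.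
Proof.
move=> p0 [mf ifp]; rewrite /Lnrm.
under eq_Rintegral do rewrite normrM powRM //.
rewrite RintegralZl // powRM ?powR_ge0 //; last first.
  by apply: Rintegral_ge0 => x _; exact: powR_ge0.
by rewrite -powRrM divff ?gt_eqF // powRr1.
Qed.

Lemma Lmem_enorm v : Lmem_vec mu Om s v -> Lmem mu Om s (fun x => enorm (v x)).
Proof.
move=> [mv iv]; split; first exact: measurable_enorm.
by under eq_fun do rewrite ger0_norm ?enorm_ge0 //.
Qed.

Lemma Lmem_vecZ a v : Lmem_vec mu Om s v -> Lmem_vec mu Om s (fun x => a *: v x).
Proof.
move=> Lv; have [mv iv] := Lv; split.
  move=> i; rewrite [X in measurable_fun _ X](_ : _ = (fun x : BRn R n => a * v x 0 i)).
    exact: measurable_funM.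
  by apply/funext => x; rewrite mxE.
under eq_fun do rewrite enormZ powRM ?enorm_ge0 // EFinM.
exact: integrableZl.
Qed.

Lemma Lnrm_vecZ a v : Lmem_vec mu Om s v ->
  Lnrm_vec mu Om s (fun x => a *: v x) = `|a| * Lnrm_vec mu Om s v.
Proof.
move=> Lv; rewrite /Lnrm_vec.
rewrite (_ : (fun x => enorm (a *: v x)) = (fun x => `|a| * enorm (v x))).
  by rewrite (LnrmZ _ s0 (Lmem_enorm Lv)) normr_id.
by apply/funext => x; rewrite enormZ.
Qed.

Lemma integrable_mul_bounded (f phi : Rn -> R) (M : R) :
  mu.-integrable (Om : set (BRn R n)) (fun x : BRn R n => (f x)%:E) ->
  continuous phi -> (forall x, `|phi x| <= M) ->
  mu.-integrable (Om : set (BRn R n)) (fun x : BRn R n => (f x * phi x)%:E).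
Proof.
move=> iF cphi bM; have := integrableZl mOm M iF; apply: le_integrable => //.
  apply/measurable_EFinP/measurable_funM.
    by apply/measurable_EFinP; exact: measurable_int iF.
  by apply: measurable_funTS; exact: continuous_measurable_Rn.
move=> x _; rewrite abseM /= normrM lee_fin mulrC ler_wpM2r //.
by apply: le_trans (bM x) _; exact: ler_norm.
Qed.

(** Allows a scalar to be pulled out of the integral that defines the weak divergence. *)
Lemma integrable_edot_grad v phi : Lmem_vec mu Om s v -> test_fun Om phi ->
  mu.-integrable (Om : set (BRn R n)) (fun x : BRn R n => (edot (v x) (grad phi x))%:E).
Proof.
move=> Lv tphi; have [mv _] := Lv.
under eq_fun do rewrite /edot -sumEFin.
apply: integrable_sum => // i _.
have [_ _ cD _ [M bM]] := test_fun_deriv i tphi.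
rewrite (_ : (fun _ => _) = (fun x : BRn R n => (v x 0 i * 'D_(ebasis R i) phi x)%:E)).
  apply: (@integrable_mul_bounded (fun x => v x 0 i) (fun x => 'D_(ebasis R i) phi x) M) => //.
    have := Lmem_integrable leb oOm bOm s0 r0 rs (Lmem_enorm Lv).
    by apply: le_integrable_EFin => // x _; exact: norm_coord_le_enorm.
  by move=> x; exact: (bM x).2.
by apply/funext => x; rewrite mxE.
Qed.

Lemma VmemZ a v g : Vmem mu Om s v g ->
  Vmem mu Om s (fun x => a *: v x) (fun x => a * g x).
Proof.
move=> [Lv Lg wd]; split; [exact: Lmem_vecZ|exact: LmemZ|].
move=> phi tphi.
under eq_Rintegral do rewrite edotZl.
rewrite RintegralZl //; last exact: integrable_edot_grad.
under [in RHS]eq_Rintegral do rewrite -mulrA.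
rewrite RintegralZl //; first by rewrite wd // mulrN.
have [cphi _ _ _ [M bM]] := test_fun_deriv (Ordinal n0) tphi.
apply: (@integrable_mul_bounded g phi M) => //; last by move=> x; exact: (bM x).1.
exact: (Lmem_integrable leb oOm bOm s0 r0 rs Lg).
Qed.

Lemma VnrmZ a v g : Vmem mu Om s v g ->
  Vnrm mu Om s (fun x => a *: v x) (fun x => a * g x) = `|a| * Vnrm mu Om s v g.
Proof.
move=> [Lv Lg _]; rewrite /Vnrm (Lnrm_vecZ _ Lv) (LnrmZ _ s0 Lg).
have A0 : 0 <= Lnrm_vec mu Om s v by exact: Lnrm_ge0.
have B0 := Lnrm_ge0 s g.
move: (Lnrm_vec mu Om s v) (Lnrm mu Om s g) A0 B0 => A B A0 B0.
rewrite !powRM // -mulrDr powRM ?addr_ge0 ?powR_ge0 //.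
by rewrite -powRrM divff ?gt_eqF // powRr1.
Qed.

Variable Fc : (Rn -> Rn) -> (Rn -> R) -> R.
Hypothesis wFc : Wdual mu Om s r Fc.

Lemma WdualZ a v g q : Vmem mu Om s v g -> Lmem mu Om r q ->
  Fc (fun x => a *: v x) (fun x => a * q x) = a * Fc v q.
Proof.
move=> Vv Lq; have [lin _] := wFc; have := lin a 0 v g q v g q Vv Lq Vv Lq.
rewrite mul0r addr0 => <-; congr (Fc _ _).
  by apply/funext => x; rewrite scale0r addr0.
by apply/funext => x; rewrite mul0r addr0.
Qed.

Notation set1 :=
  [set `|Fc v (fun=> 0)| | v in [set v | exists g, Vmem mu Om s v g /\ Vnrm mu Om s v g <= 1]].
Notation set2 :=
  [set `|Fc (fun=> 0) q| | q in [set q | Lmem mu Om r q /\ Lnrm mu Om r q <= 1]].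
Notation setW :=
  [set `|Fc vq.1 vq.2| | vq in
        [set vq | exists g, [/\ Vmem mu Om s vq.1 g, Lmem mu Om r vq.2 &
                               Vnrm mu Om s vq.1 g + Lnrm mu Om r vq.2 <= 1]]].

(** The unit ball of V sits in that of W, with zero as second entry. Finiteness of the dual norm on
    V and its comparison with the one on W both follow. *)
Lemma sub_set1 : set1 `<=` setW.
Proof.
move=> _ [v [g [Vv v1]] <-]; exists (v, fun=> 0) => //; exists g; split => //=.
  exact: Lmem0.
by rewrite Lnrm0 // addr0.
Qed.

Lemma sub_set2 : set2 `<=` setW.
Proof.
move=> _ [q [Lq q1] <-]; exists (fun=> 0, q) => //; exists (fun=> 0); split => //=.
  exact: Vmem0.
by rewrite Vnrm0 add0r.
Qed.

Lemma set1_neq0 : set1 !=set0.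
Proof.
exists `|Fc (fun=> 0) (fun=> 0)|; exists (fun=> 0) => //; exists (fun=> 0).
by split; [exact: Vmem0|rewrite Vnrm0].
Qed.

Lemma set2_neq0 : set2 !=set0.
Proof.
exists `|Fc (fun=> 0) (fun=> 0)|; exists (fun=> 0) => //.
by split; [exact: Lmem0|rewrite Lnrm0].
Qed.

(** A real [sup] is an upper bound only for a nonempty set bounded above, so continuity of the
    functional must enter before any dual norm is used. The absolute value of C is taken because C
    carries no sign condition. *)
Lemma has_ubound_setW : has_ubound setW.
Proof.
have [_ [C bC]] := wFc; exists `|C| => _ [[v q] [g [Vv Lq le1]] <-] /=.
apply: le_trans (bC _ _ _ Vv Lq) _.
have nn : 0 <= Vnrm mu Om s v g + Lnrm mu Om r q.
  by rewrite addr_ge0 ?Vnrm_ge0 ?Lnrm_ge0.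
apply: (@le_trans _ _ (`|C| * (Vnrm mu Om s v g + Lnrm mu Om r q))).
  by rewrite ler_wpM2r // ler_norm.
by rewrite ler_piMr.
Qed.

Lemma has_sup_set1 : has_sup set1.
Proof.
split; first exact: set1_neq0.
have [M bM] := has_ubound_setW; exists M => x /sub_set1; exact: bM.
Qed.

Lemma has_sup_set2 : has_sup set2.
Proof.
split; first exact: set2_neq0.
have [M bM] := has_ubound_setW; exists M => x /sub_set2; exact: bM.
Qed.

Lemma has_sup_setW : has_sup setW.
Proof.
split; last exact: has_ubound_setW.
by have [x /sub_set1 Wx] := set1_neq0; exists x.
Qed.

Lemma dnorm_pi1_le_W : dnorm_pi1 mu Om s r Fc <= dnorm_W mu Om s r Fc.
Proof.
apply: ge_sup; first exact: set1_neq0.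
by move=> x /sub_set1; exact: (sup_upper_bound has_sup_setW).
Qed.

Lemma dnorm_pi2_le_W : dnorm_pi2 mu Om s r Fc <= dnorm_W mu Om s r Fc.
Proof.
apply: ge_sup; first exact: set2_neq0.
by move=> x /sub_set2; exact: (sup_upper_bound has_sup_setW).
Qed.

Lemma dnorm_pi1_ge0 : 0 <= dnorm_pi1 mu Om s r Fc.
Proof.
have [x x1] := set1_neq0; apply: le_trans (sup_upper_bound has_sup_set1 x1).
by case: x1 => v _ <-.
Qed.

Lemma dnorm_pi2_ge0 : 0 <= dnorm_pi2 mu Om s r Fc.
Proof.
have [x x1] := set2_neq0; apply: le_trans (sup_upper_bound has_sup_set2 x1).
by case: x1 => v _ <-.
Qed.

(** Normalise v. Elements are functions and not classes, so a nonzero v may have norm zero;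
    continuity then makes the functional vanish on it. *)
Lemma dnorm_pi1_bound v g : Vmem mu Om s v g ->
  `|Fc v (fun=> 0)| <= dnorm_pi1 mu Om s r Fc * Vnrm mu Om s v g.
Proof.
move=> Vv; have [N0|N0] := eqVneq (Vnrm mu Om s v g) 0.
  have [_ [C bC]] := wFc; have := bC _ _ _ Vv (Lmem0 r0).
  by rewrite N0 Lnrm0 // addr0 !mulr0.
have Np : 0 < Vnrm mu Om s v g by rewrite lt_def N0 Vnrm_ge0.
pose a := (Vnrm mu Om s v g)^-1.
have a0 : 0 < a by rewrite invr_gt0.
have Vav := VmemZ a Vv.
have -> : Fc v (fun=> 0) = Vnrm mu Om s v g * Fc (fun x => a *: v x) (fun=> 0).
  rewrite (_ : (fun=> 0) = (fun _ : Rn => a * (0 : R))); last first.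
    by apply/funext => x; rewrite mulr0.
  rewrite (WdualZ a Vv (Lmem0 r0)) mulrA divff // mul1r; congr (Fc _ _).
  by apply/funext => x; rewrite mulr0.
rewrite normrM (gtr0_norm Np) mulrC ler_pM2r //.
apply: (sup_upper_bound has_sup_set1); exists (fun x => a *: v x) => //.
exists (fun x => a * g x); split => //.
by rewrite (VnrmZ a Vv) (gtr0_norm a0) mulVf.
Qed.

Lemma dnorm_pi2_bound q : Lmem mu Om r q ->
  `|Fc (fun=> 0) q| <= dnorm_pi2 mu Om s r Fc * Lnrm mu Om r q.
Proof.
move=> Lq; have [N0|N0] := eqVneq (Lnrm mu Om r q) 0.
  have [_ [C bC]] := wFc; have := bC _ _ _ Vmem0 Lq.
  by rewrite N0 Vnrm0 // addr0 !mulr0.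
have Np : 0 < Lnrm mu Om r q by rewrite lt_def N0 Lnrm_ge0.
pose a := (Lnrm mu Om r q)^-1.
have a0 : 0 < a by rewrite invr_gt0.
have -> : Fc (fun=> 0) q = Lnrm mu Om r q * Fc (fun=> 0) (fun x => a * q x).
  rewrite [X in _ * X](_ : _ = Fc (fun _ : Rn => a *: (0 : Rn)) (fun x => a * q x)); last first.
    by congr (Fc _ _); apply/funext => x; rewrite scaler0.
  by rewrite (WdualZ a Vmem0 Lq) mulrA divff // mul1r.
rewrite normrM (gtr0_norm Np) mulrC ler_pM2r //.
apply: (sup_upper_bound has_sup_set2); exists (fun x => a * q x) => //.
split; first exact: LmemZ.
by rewrite (LnrmZ a r0 Lq) (gtr0_norm a0) mulVf.
Qed.

End Spaces.

(** * A priori estimates *)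

(** Cancels the power of the norm that testing with a dual power leaves on the right; used for both
    div u and p. *)
Lemma le_of_powR_le (R : realType) (x c p : R) : 1 < p -> 0 <= x -> 0 <= c ->
  x `^ p <= c * x `^ (p - 1) -> x <= c.
Proof.
move=> p1 x0 c0; rewrite -powRS //; have [->|nx] := eqVneq x 0; first by [].
by rewrite ler_pM2r // powR_gt0 // lt_def nx.
Qed.

(** Here Q stands for P^(r-1), Us for U^(s-1), V for the norm of the test field and K for the
    embedding constant. The factor in front is the constant of the pressure bound. *)
Lemma pressure_combine (R : realType) (c1 K L U Us b V Q : R) :
  0 < c1 -> 0 <= K -> 0 < L -> 0 <= U -> 0 <= Us -> 0 <= b -> 0 <= Q ->
  V <= L * Q ->
  c1 * (K * U + Us) * V + b * (V + Q)
  <= (c1 * (K + 1) * L + (L + 1)) * (U + Us + b) * Q.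
Proof.
move=> c10 K0 L0 U0 Us0 b0 Q0 vL.
have h1 : K * U + Us <= (K + 1) * (U + Us + b).
  have a1 : 0 <= K * Us by rewrite mulr_ge0.
  have a2 : 0 <= K * b by rewrite mulr_ge0.
  by rewrite !mulrDr !mulrDl; lra.
have A0 : 0 <= K * U + Us by rewrite addr_ge0 // mulr_ge0.
have step1 : c1 * (K * U + Us) * V <= c1 * (K + 1) * L * (U + Us + b) * Q.
  apply: (@le_trans _ _ (c1 * (K * U + Us) * (L * Q))).
    by rewrite ler_wpM2l // mulr_ge0 // ltW.
  have -> : c1 * (K + 1) * L * (U + Us + b) * Q = c1 * ((K + 1) * (U + Us + b)) * (L * Q) by ring.
  by rewrite ler_wpM2r ?mulr_ge0 ?(ltW L0) // ler_pM2l.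
have step2 : b * (V + Q) <= (L + 1) * (U + Us + b) * Q.
  apply: (@le_trans _ _ (b * ((L + 1) * Q))).
    by rewrite ler_wpM2l // mulrDl mul1r lerD2r.
  rewrite mulrCA mulrA -[leRHS]mulrA -[leLHS]mulrA ler_wpM2l ?addr_ge0 ?(ltW L0) //.
  by rewrite ler_wpM2r // lerDr addr_ge0.
by rewrite [X in _ <= X * _]mulrDl [leRHS]mulrDl; exact: lerD.
Qed.

Section Estimates.
Variables (R : realType) (n : nat) (mu : {measure set (BRn R n) -> \bar R}).
Hypothesis leb : is_lebesgue mu.
Notation Rn := 'rV[R]_n.
Variable Om : set Rn.
Hypotheses (n0 : (0 < n)%N) (oOm : open Om) (bOm : bounded_set Om).
Variables (s c1 c2 : R) (Fn : Rn -> Rn).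
Hypotheses (s2 : 2 < s) (c10 : 0 < c1) (c20 : 0 < c2) (Fn0 : Fn 0 = 0).
Hypothesis lipF : forall x y, enorm (Fn x - Fn y)
  <= c1 * (1 + enorm x `^ (s - 2) + enorm y `^ (s - 2)) * enorm (x - y).
Hypothesis monF : forall x y, edot (Fn x - Fn y) (x - y) >= c2 * enorm (x - y) `^ s.
Notation r := (s / (s - 1)).

Let mOm : measurable (Om : set (BRn R n)).
Proof. exact: measurable_domain. Qed.

Lemma s_gt1 : 1 < s.
Proof. by apply: lt_trans s2; rewrite ltr1n. Qed.

Lemma s_gt0 : 0 < s.
Proof. exact: lt_trans ltr01 s_gt1. Qed.

Lemma r_gt1 : 1 < r.
Proof. by have [] := conj_sub1_bounds s2; rewrite subr_gt0. Qed.

Lemma r_gt0 : 0 < r.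
Proof. exact: lt_trans ltr01 r_gt1. Qed.

Lemma conj_rs : r^-1 + s^-1 = 1.
Proof. by rewrite invf_div mulrBl mul1r divff ?gt_eqF ?s_gt0 // subrK. Qed.

Lemma sub1s_r : (s - 1) * r = s.
Proof. by rewrite mulrC divfK // sub1_neq0. Qed.

Lemma sub1r_s : (r - 1) * s = r.
Proof.
have h := conj_sub1 s2; have e : s = (s - 1) + 1 by ring.
by rewrite {3}e mulrDr h mulr1 addrC subrK.
Qed.

Lemma Lnrm_powE (p : R) (f : Rn -> R) : 0 < p ->
  Lnrm mu Om p f `^ p = Rintegral mu (Om : set (BRn R n)) (fun x : BRn R n => `|f x| `^ p).
Proof. by move=> p0; rewrite /Lnrm Lnorm_powK // gt_eqF. Qed.

Lemma Lmem_dual_power (p q : R) (f : Rn -> R) : 1 < p -> (p - 1) * q = p ->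
  Lmem mu Om p f -> Lmem mu Om q (dual_power p (f : BRn R n -> R)).
Proof.
move=> p1 pq [mf iF]; split; first exact: measurable_dual_power.
by under eq_fun do rewrite (norm_dual_power_pow _ _ p1 pq).
Qed.

Lemma Lnrm_dual_power (p q : R) (f : Rn -> R) : 1 < p -> 0 < q -> (p - 1) * q = p ->
  Lnrm mu Om q (dual_power p (f : BRn R n -> R)) = Lnrm mu Om p f `^ (p - 1).
Proof.
move=> p1 q0 pq; have p0 : 0 < p by exact: lt_trans p1.
rewrite {1}/Lnrm; under eq_Rintegral do rewrite (norm_dual_power_pow _ _ p1 pq).
rewrite -(Lnrm_powE f p0) -powRrM; congr (_ `^ _).
by rewrite -{1}pq mulfK // gt_eqF.
Qed.

Lemma Rintegral_dual_power (p : R) (f : Rn -> R) : 1 < p ->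
  Rintegral mu (Om : set (BRn R n))
    (fun x : BRn R n => f x * dual_power p (f : BRn R n -> R) x) = Lnrm mu Om p f `^ p.
Proof.
move=> p1; rewrite Lnrm_powE; last exact: lt_trans p1.
by apply: eq_Rintegral => x _; rewrite mul_dual_power.
Qed.

Lemma Lmem_hoelder (f g : Rn -> R) : Lmem mu Om r f -> Lmem mu Om s g ->
  mu.-integrable (Om : set (BRn R n)) (fun x : BRn R n => (f x * g x)%:E).
Proof.
move=> [mf iF] [mg ig].
by apply: (hoelder_integrable mOm r_gt0 s_gt0 conj_rs).
Qed.

Lemma Rintegral_hoelder (f g : Rn -> R) : Lmem mu Om r f -> Lmem mu Om s g ->
  Rintegral mu (Om : set (BRn R n)) (fun x : BRn R n => `|f x| * `|g x|)
  <= Lnrm mu Om r f * Lnrm mu Om s g.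
Proof.
move=> [mf iF] [mg ig].
exact: (hoelder_Rintegral mOm r_gt0 s_gt0 conj_rs mf mg iF ig).
Qed.

Lemma norm_Rintegral_hoelder (f g : Rn -> R) : Lmem mu Om r f -> Lmem mu Om s g ->
  `|Rintegral mu (Om : set (BRn R n)) (fun x : BRn R n => f x * g x)|
  <= Lnrm mu Om r f * Lnrm mu Om s g.
Proof.
move=> Lf Lg; apply: le_trans (Rintegral_hoelder Lf Lg).
apply: le_trans (le_normr_Rintegral mOm (Lmem_hoelder Lf Lg)) _.
rewrite le_eqVlt; apply/orP; left; apply/eqP.
by apply: eq_Rintegral => x _; rewrite normrM.
Qed.

(** Equal to |Om|^(1/r - 1/s), the constant of the embedding of L^s in L^r, in the form in which
    Hölder's inequality delivers it. *)
Definition embed_cst : R :=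
  (fine (mu (Om : set (BRn R n))) `^ ((s - 1) / (s - 2))^-1) `^ r^-1.

Lemma embed_cst_ge0 : 0 <= embed_cst.
Proof. exact: powR_ge0. Qed.

(* Hoelder's inequality for [|f| `^ r] and [1], with exponents [s - 1] and
   [(s - 1) / (s - 2)]. *)
Lemma Lmem_embed (f : Rn -> R) : Lmem mu Om s f ->
  Lmem mu Om r f /\ Lnrm mu Om r f <= embed_cst * Lnrm mu Om s f.
Proof.
move=> [mf iF].
have s20 : 0 < s - 2 by rewrite subr_gt0.
have s10 : 0 < s - 1 by rewrite subr_gt0 s_gt1.
have q0 : 0 < (s - 1) / (s - 2) by rewrite divr_gt0.
have pq : (s - 1)^-1 + ((s - 1) / (s - 2))^-1 = 1.
  rewrite invf_div -[X in X + _]mul1r -mulrDl.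
  have -> : 1 + (s - 2) = s - 1 by ring.
  by rewrite divff // gt_eqF.
have mfr := measurable_norm_powR r mf.
have m1 : measurable_fun (Om : set (BRn R n)) (fun _ : BRn R n => 1 : R).
  exact: measurable_cst.
have frE x : `| `|f x| `^ r| `^ (s - 1) = `|f x| `^ s.
  by rewrite ger0_norm ?powR_ge0 // -powRrM divfK // gt_eqF.
have i1 : mu.-integrable (Om : set (BRn R n))
    (fun x : BRn R n => (`| `|f x| `^ r| `^ (s - 1))%:E).
  by under eq_fun do rewrite frE.
have i2 : mu.-integrable (Om : set (BRn R n))
    (fun x : BRn R n => (`|1 : R| `^ ((s - 1) / (s - 2)))%:E).
  by under eq_fun do rewrite normr1 powR1; exact: integrable_cst_domain.
have ifr : mu.-integrable (Om : set (BRn R n)) (fun x : BRn R n => (`|f x| `^ r)%:E).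
  have := hoelder_integrable mOm s10 q0 pq mfr m1 i1 i2.
  by under eq_fun do rewrite mulr1.
split; first by split.
have := hoelder_Rintegral mOm s10 q0 pq mfr m1 i1 i2.
under eq_Rintegral do rewrite normr1 mulr1 ger0_norm ?powR_ge0 //.
under [X in _ <= X `^ _ * _]eq_Rintegral do rewrite frE.
under [X in _ <= _ * X `^ _]eq_Rintegral do rewrite normr1 powR1.
rewrite (Rintegral_cst mu mOm) mul1r -(Lnrm_powE f s_gt0) => h.
have rV0 : 0 <= r^-1 by rewrite invr_ge0 ltW // r_gt0.
rewrite {1}/Lnrm; apply: le_trans (powR_le rV0 _ h) _.
  by apply: Rintegral_ge0 => x _; exact: powR_ge0.
have N0 := Lnrm_ge0 mu Om s f.
move: (Lnrm mu Om s f) N0 {h} => A N0.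
rewrite /embed_cst; move: (fine _ `^ _) (powR_ge0 (fine (mu Om)) ((s - 1) / (s - 2))^-1).
move=> W W0; rewrite (powRM _ (powR_ge0 _ _) W0) mulrC.
apply: ler_wpM2l; first exact: powR_ge0.
rewrite -powRrM -powRrM mulrA divff; last by rewrite gt_eqF // r_gt0.
by rewrite powRr1.
Qed.

(** The growth of F has two parts. The linear one is put in L^r by the embedding; the power
    |u|^(s-1) is the dual power of |u|, with L^r norm exactly U^(s-1). Each is paired with |v| by
    Hölder. *)
Lemma Fn_pairing (u v : Rn -> Rn) : Lmem_vec mu Om s u -> Lmem_vec mu Om s v ->
  mu.-integrable (Om : set (BRn R n)) (fun x : BRn R n => (edot (Fn (u x)) (v x))%:E) /\
  `|Rintegral mu (Om : set (BRn R n)) (fun x : BRn R n => edot (Fn (u x)) (v x))|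
  <= c1 * (embed_cst * Lnrm_vec mu Om s u + Lnrm_vec mu Om s u `^ (s - 1))
     * Lnrm_vec mu Om s v.
Proof.
move=> Lu Lv; have [mu_ _] := Lu; have [mv _] := Lv.
pose a x := enorm (u x); pose b x := enorm (v x).
have La : Lmem mu Om s a by exact: Lmem_enorm.
have Lb : Lmem mu Om s b by exact: Lmem_enorm.
have [Lar Nar] := Lmem_embed La.
pose a' : Rn -> R := dual_power s (a : BRn R n -> R).
have La' : Lmem mu Om r a' by apply: Lmem_dual_power => //; [exact: s_gt1|exact: sub1s_r].
have Na' : Lnrm mu Om r a' = Lnrm mu Om s a `^ (s - 1).
  by apply: Lnrm_dual_power; [exact: s_gt1|exact: r_gt0|exact: sub1s_r].
have a'E x : `|a' x| = a x `^ (s - 1).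
  by rewrite norm_dual_power ?s_gt1 // ger0_norm // enorm_ge0.
have absb x : `|b x| = b x by rewrite ger0_norm // enorm_ge0.
have absa x : `|a x| = a x by rewrite ger0_norm // enorm_ge0.
have mE : measurable_fun (Om : set (BRn R n)) (fun x : BRn R n => edot (Fn (u x)) (v x)).
  apply: measurable_edot => // i.
  apply: (@measurable_fun_Rn_comp _ _ Om u (fun x => Fn x 0 i)) => //.
  exact: (continuous_coord_Fn s2 c10 lipF).
pose h x := c1 * (`|a x| * `|b x| + `|a' x| * `|b x|).
have bound x : `|edot (Fn (u x)) (v x)| <= h x.
  apply: le_trans (Cauchy_Schwarz _ _) _.
  apply: (@le_trans _ _ (c1 * (a x + a x `^ (s - 1)) * b x)).
    rewrite ler_wpM2r ?enorm_ge0 //.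
    exact: (growth_bound s2 Fn0 lipF).
  by rewrite /h a'E absa absb -mulrDl mulrA.
have iab : mu.-integrable (Om : set (BRn R n)) (fun x : BRn R n => (`|a x| * `|b x|)%:E).
  by under eq_fun do rewrite absa absb; exact: Lmem_hoelder.
have iab' : mu.-integrable (Om : set (BRn R n)) (fun x : BRn R n => (`|a' x| * `|b x|)%:E).
  by under eq_fun do rewrite -normrM; exact: (integrable_norm (Lmem_hoelder La' Lb)).
have isum : mu.-integrable (Om : set (BRn R n))
    (fun x : BRn R n => (`|a x| * `|b x| + `|a' x| * `|b x|)%:E).
  by under eq_fun do rewrite EFinD; exact: integrableD.
have ih : mu.-integrable (Om : set (BRn R n)) (fun x : BRn R n => (h x)%:E).
  by under eq_fun do rewrite EFinM; exact: integrableZl.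
have iE : mu.-integrable (Om : set (BRn R n)) (fun x : BRn R n => (edot (Fn (u x)) (v x))%:E).
  exact: (le_integrable_EFin mOm mE (fun x _ => bound x) ih).
split; first exact: iE.
apply: le_trans (le_normr_Rintegral mOm iE) _.
have iEn : mu.-integrable (Om : set (BRn R n))
    (fun x : BRn R n => (`|edot (Fn (u x)) (v x)|)%:E).
  exact: (integrable_norm iE).
apply: le_trans (le_Rintegral mOm iEn ih (fun x _ => bound x)) _.
rewrite /h (RintegralZl c1 mOm isum) (RintegralD mOm iab iab') -mulrA.
rewrite (ler_pM2l c10) mulrDl.
have N0 := Lnrm_ge0 mu Om s b.
apply: lerD.
  apply: le_trans (Rintegral_hoelder Lar Lb) _.
  exact: (ler_wpM2r N0 Nar).
by rewrite -[Lnrm_vec mu Om s u `^ _]Na'; exact: Rintegral_hoelder La' Lb.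
Qed.

Variables (Fc : (Rn -> Rn) -> (Rn -> R) -> R) (u : Rn -> Rn) (gu p : Rn -> R).
Hypotheses (wFc : Wdual mu Om s r Fc) (Vu : Vmem mu Om s u gu) (Lp : Lmem mu Om r p).
Hypothesis sol : solves mu Om s r Fn Fc u gu p.
Notation beta := (dnorm_pi1 mu Om s r Fc).
Notation gamma := (dnorm_pi2 mu Om s r Fc).
Notation U := (Lnrm_vec mu Om s u).
Notation G := (Lnrm mu Om s gu).
Notation P := (Lnrm mu Om r p).

Lemma Rintegral0 : Rintegral mu (Om : set (BRn R n)) (fun=> 0) = 0.
Proof. by rewrite (Rintegral_cst mu mOm) mul0r. Qed.

Lemma solves_at_v (v : Rn -> Rn) (gv : Rn -> R) : Vmem mu Om s v gv ->
  Rintegral mu (Om : set (BRn R n)) (fun x : BRn R n => edot (Fn (u x)) (v x))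
  - Rintegral mu (Om : set (BRn R n)) (fun x : BRn R n => gv x * p x)
  = Fc v (fun=> 0).
Proof.
move=> Vv; rewrite -(sol Vv (Lmem0 leb oOm bOm r_gt0)).
under [X in _ = _ + X]eq_Rintegral do rewrite mulr0.
by rewrite Rintegral0 addr0.
Qed.

Lemma solves_at_q (q : Rn -> R) : Lmem mu Om r q ->
  Rintegral mu (Om : set (BRn R n)) (fun x : BRn R n => gu x * q x) = Fc (fun=> 0) q.
Proof.
move=> Lq; rewrite -(sol (Vmem0 leb oOm bOm s_gt0) Lq).
under [X in _ = X - _ + _]eq_Rintegral do rewrite edotC edot0l.
under [X in _ = _ - X + _]eq_Rintegral do rewrite mul0r.
by rewrite Rintegral0 subr0 add0r.
Qed.

(** For q the dual power of div u, G^s = F(0, q) <= gamma |q|_r = gamma G^(s-1). *)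
Lemma divergence_estimate : G <= gamma.
Proof.
have [_ Lgu _] := Vu.
apply: (le_of_powR_le s_gt1 (Lnrm_ge0 _ _ _ _)).
  exact: (dnorm_pi2_ge0 leb oOm bOm s_gt0 r_gt0 wFc).
have Lq := Lmem_dual_power s_gt1 sub1s_r Lgu.
rewrite -(Rintegral_dual_power _ s_gt1) (solves_at_q Lq).
rewrite -(Lnrm_dual_power gu s_gt1 r_gt0 sub1s_r).
apply: le_trans (ler_norm _) _.
exact: (dnorm_pi2_bound leb oOm bOm s_gt0 r_gt0 wFc).
Qed.

Lemma Vnrm_le (v : Rn -> Rn) (g : Rn -> R) :
  Vnrm mu Om s v g <= Lnrm_vec mu Om s v + Lnrm mu Om s g.
Proof.
by apply: addr_powR_inv_le; [exact: ltW s_gt1|exact: Lnrm_ge0|exact: Lnrm_ge0].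
Qed.

Lemma norm_Fc_v_le (v : Rn -> Rn) (g : Rn -> R) : Vmem mu Om s v g ->
  `|Fc v (fun=> 0)| <= beta * (Lnrm_vec mu Om s v + Lnrm mu Om s g).
Proof.
move=> Vv.
apply: le_trans (dnorm_pi1_bound leb n0 oOm bOm s_gt0 r_gt0 conj_rs wFc Vv) _.
apply: (ler_wpM2l _ (Vnrm_le _ _)).
exact: (dnorm_pi1_ge0 leb oOm bOm s_gt0 r_gt0 wFc).
Qed.

Lemma energy_estimate : c2 * U `^ s <= beta * (U + G) + G * P.
Proof.
have [Lu Lgu _] := Vu.
have [iE _] := Fn_pairing Lu Lu.
have [_ ia] := Lmem_enorm Lu.
have le1 : c2 * U `^ s <=
    Rintegral mu (Om : set (BRn R n)) (fun x : BRn R n => edot (Fn (u x)) (u x)).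
  rewrite /Lnrm_vec (Lnrm_powE _ s_gt0) -(RintegralZl c2 mOm ia).
  apply: (le_Rintegral mOm) => //.
    by rewrite /comp; under eq_fun do rewrite EFinM; exact: integrableZl.
  (* Monotonicity against y = 0 is coercivity, as F(0) = 0. *)
  move=> x _; have := monF (u x) 0; rewrite Fn0 !subr0.
  by rewrite ger0_norm ?enorm_ge0.
apply: (le_trans le1); have := solves_at_v Vu; move/eqP; rewrite subr_eq => /eqP ->.
apply: lerD; first exact: le_trans (ler_norm _) (norm_Fc_v_le Vu).
apply: le_trans (ler_norm _) _.
under eq_Rintegral do rewrite mulrC.
by rewrite [G * P]mulrC; exact: norm_Rintegral_hoelder.
Qed.

(** With g the dual power of p, the integral of g p is P^r and |g|_s = P^(r-1). Every other term
    carries a factor P^(r-1), which is cancelled. Solvability of div v = g is a hypothesis here so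
    that L can be fixed before the functional and the solution. *)
Lemma pressure_estimate (L : R) : 0 < L ->
  (forall g, Lmem mu Om s g ->
    exists2 v, Vmem mu Om s v g & Lnrm_vec mu Om s v <= L * Lnrm mu Om s g) ->
  P <= (c1 * (embed_cst + 1) * L + (L + 1)) * (U + U `^ (s - 1) + beta).
Proof.
move=> L0 inv; have [Lu _ _] := Vu.
have Lg := Lmem_dual_power r_gt1 sub1r_s Lp.
have Ng := Lnrm_dual_power p r_gt1 s_gt0 sub1r_s.
have [v Vv] := inv _ Lg; rewrite Ng => vL; have [Lv _ _] := Vv.
have [_ FV] := Fn_pairing Lu Lv.
have FcV := norm_Fc_v_le Vv; rewrite Ng in FcV.
have E := solves_at_v Vv.
have b0 : 0 <= beta by exact: (dnorm_pi1_ge0 leb oOm bOm s_gt0 r_gt0 wFc).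
have U0 : 0 <= U by exact: Lnrm_ge0.
have K0 := embed_cst_ge0.
have S0 : 0 <= U + U `^ (s - 1) + beta by rewrite !addr_ge0 ?powR_ge0.
apply: (le_of_powR_le r_gt1 (Lnrm_ge0 _ _ _ _)).
  by rewrite mulr_ge0 // !addr_ge0 ?mulr_ge0 ?addr_ge0 // ltW.
rewrite -{1}(Rintegral_dual_power p r_gt1).
under eq_Rintegral do rewrite mulrC.
move: E => /eqP; rewrite subr_eq addrC -subr_eq => /eqP <-.
apply: le_trans (ler_norm _) _; apply: le_trans (ler_normB _ _) _.
apply: le_trans (lerD FV FcV) _.
have Q0 : 0 <= P `^ (r - 1) by exact: powR_ge0.
have Us0 : 0 <= U `^ (s - 1) by exact: powR_ge0.
exact: (pressure_combine c10 K0 L0 U0 Us0 b0 Q0 vL).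
Qed.

End Estimates.

(** Isolates the real-number argument, with constants that depend on s, c2 and C2 only. N stands for
    the norm in W, nF for the dual norm there. *)
Lemma scalar_conclusion (R : realType) (s c2 C2 : R) : 2 < s -> 0 < c2 -> 0 <= C2 ->
  let r := s / (s - 1) in
  exists c7 c8 c9 : R, [/\ 0 < c7, 0 < c8, 0 < c9 &
    forall beta gamma nF U G P N : R,
      0 <= beta -> 0 <= gamma -> 0 <= U -> 0 <= G -> beta <= nF -> gamma <= nF ->
      G <= gamma -> P <= C2 * (U + U `^ (s - 1) + beta) ->
      c2 * U `^ s <= beta * (U + G) + G * P -> N <= U + G + P ->
      [/\ U <= c7 * (beta `^ (r - 1) + gamma `^ (r - 1) + gamma),
          G <= c7 * gamma,
          P <= c7 * (gamma `^ (r - 1) + gamma `^ (s - 1) + beta `^ (r - 1) + beta),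
          N <= c8 * (gamma `^ (r - 1) + gamma `^ (s - 1) + beta `^ (r - 1) + beta) &
          N <= c9 * (nF `^ (r - 1) + nF `^ (s - 1))]].
Proof.
move=> s2 c20 C20 r.
have [r0 r1] := conj_sub1_bounds s2.
pose C3 := 1 + (2 + 3 * C2) / c2.
have C30 : 1 <= C3 by rewrite lerDl divr_ge0 ?(ltW c20) // addr_ge0 // mulr_ge0.
pose CP := C2 * (2 * C3 + (3 * C3) `^ (s - 1) * 2 + 1).
have CP0 : 0 <= CP.
  have := powR_ge0 (3 * C3) (s - 1) => h.
  by rewrite mulr_ge0 //; lra.
(* [C3] serves U and, being at least 1, div u; [CP] serves p. The second constant adds the three
   bounds in terms of S. The factor 3 comes from S <= 2 nF^(r-1) + nF^(s-1) + nF, where the last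
   term is at most the sum of the two powers. *)
exists (C3 + CP), (2 * C3 + 1 + CP), ((2 * C3 + 1 + CP) * 3); split; [lra|lra|lra|].
move=> beta gamma nF U G P N b0 g0 U0 G0 bF gF Gg PC en NU.
have s10 : 0 <= s - 1 by lra.
have pb : 0 <= beta `^ (r - 1) by exact: powR_ge0.
have pg : 0 <= gamma `^ (r - 1) by exact: powR_ge0.
have pgs : 0 <= gamma `^ (s - 1) by exact: powR_ge0.
(* Chosen so that M^(s-1) dominates beta and gamma, and M dominates gamma: the three thresholds of
   the energy comparison. *)
pose M := beta `^ (r - 1) + gamma `^ (r - 1) + gamma.
have M0 : 0 <= M by rewrite /M !addr_ge0.
have rootK x : 0 <= x -> x = (x `^ (r - 1)) `^ (s - 1).
  by move=> x0; rewrite -powRrM (conj_sub1 s2) powRr1.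
have bM : beta <= M `^ (s - 1).
  by rewrite {1}(rootK _ b0); apply: powR_le => //; rewrite /M; lra.
have gM : gamma <= M `^ (s - 1).
  by rewrite {1}(rootK _ g0); apply: powR_le => //; rewrite /M; lra.
have gM1 : gamma <= M by rewrite /M; lra.
have UM : U <= C3 * M := energy_bound s2 c20 C20 b0 g0 U0 G0 M0 bM gM gM1 Gg PC en.
have C3ge0 : 0 <= C3 by lra.
have [US gS PS] := pressure_bound s2 C20 C3ge0 b0 g0 U0 UM PC.
rewrite -/CP -/r in US gS PS.
set S := gamma `^ (r - 1) + _ + _ + _ in US gS PS *.
have S0 : 0 <= S by rewrite /S !addr_ge0.
have NS : N <= (2 * C3 + 1 + CP) * S.
  by rewrite !mulrDl mul1r; lra.
have nF0 : 0 <= nF by exact: le_trans bF.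
have SF : S <= 3 * (nF `^ (r - 1) + nF `^ (s - 1)).
  have h1 : gamma `^ (r - 1) <= nF `^ (r - 1) by apply: powR_le => //; exact: ltW.
  have h2 : gamma `^ (s - 1) <= nF `^ (s - 1) by exact: powR_le.
  have h3 : beta `^ (r - 1) <= nF `^ (r - 1) by apply: powR_le => //; exact: ltW.
  have h4 : nF <= nF `^ (r - 1) + nF `^ (s - 1).
    by apply: le_powR_add => //; [exact: ltW|lra].
  have h5 : 0 <= nF `^ (r - 1) by exact: powR_ge0.
  have h6 : 0 <= nF `^ (s - 1) by exact: powR_ge0.
  by rewrite /S; lra.
split.
- by rewrite -/M; apply: (le_trans UM); rewrite ler_wpM2r // lerDl.
- by apply: (le_trans Gg); rewrite ler_peMl //; lra.
- by apply: (le_trans PS); rewrite ler_wpM2r // lerDr.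
- exact: NS.
- apply: (le_trans NS); rewrite -mulrA ler_wpM2l //; lra.
Qed.

Theorem mainTheorem17 (R : realType) (n : nat) (Om : set 'rV[R]_n)
    (mu : {measure set (BRn R n) -> \bar R})
    (s c1 c2 : R) (Fn : 'rV[R]_n -> 'rV[R]_n) :
  (2 <= n)%N ->
  is_lebesgue mu ->
  open Om -> bounded_set Om -> C1_boundary Om ->
  2 < s -> 0 < c1 -> 0 < c2 ->
  Fn 0 = 0 ->
  (forall x y, enorm (Fn x - Fn y)
       <= c1 * (1 + enorm x `^ (s - 2) + enorm y `^ (s - 2)) * enorm (x - y)) ->
  (forall x y, edot (Fn x - Fn y) (x - y) >= c2 * enorm (x - y) `^ s) ->
  let r := s / (s - 1) in
  exists c7 c8 c9 : R, [/\ 0 < c7, 0 < c8, 0 < c9 &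
    forall (Fc : ('rV[R]_n -> 'rV[R]_n) -> ('rV[R]_n -> R) -> R)
           (u : 'rV[R]_n -> 'rV[R]_n) (gu : 'rV[R]_n -> R) (p : 'rV[R]_n -> R),
      Wdual mu Om s r Fc ->
      Vmem mu Om s u gu -> Lmem mu Om r p ->
      solves mu Om s r Fn Fc u gu p ->
      let beta := dnorm_pi1 mu Om s r Fc in
      let gamma := dnorm_pi2 mu Om s r Fc in
      let nF := dnorm_W mu Om s r Fc in
      let nW := Vnrm mu Om s u gu + Lnrm mu Om r p in
      [/\ Lnrm_vec mu Om s u <= c7 * (beta `^ (r - 1) + gamma `^ (r - 1) + gamma),
          Lnrm mu Om s gu <= c7 * gamma,
          Lnrm mu Om r p <= c7 * (gamma `^ (r - 1) + gamma `^ (s - 1)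
                                  + beta `^ (r - 1) + beta),
          nW <= c8 * (gamma `^ (r - 1) + gamma `^ (s - 1) + beta `^ (r - 1) + beta) &
          nW <= c9 * (nF `^ (r - 1) + nF `^ (s - 1))]].
Proof.
move=> n2 leb oOm bOm _ s2 c10 c20 Fn0 lipF monF r.
have n0 : (0 < n)%N by exact: ltn_trans n2.
have s0 := s_gt0 s2; have r0 := r_gt0 s2.
(* L is fixed before the functional and the solution are introduced, which makes all constants
   uniform in them. *)
have [L L0 inv] := divergence_right_inverse leb oOm bOm n0 s0 r0 (conj_rs s2).
have C20 : 0 <= c1 * (embed_cst mu Om s + 1) * L + (L + 1).
  have K0 := embed_cst_ge0 mu Om s.
  by rewrite !addr_ge0 ?mulr_ge0 ?addr_ge0 // ltW.
have [c7 [c8 [c9 [c70 c80 c90 concl]]]] := scalar_conclusion s2 c20 C20.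
exists c7, c8, c9; split; [exact: c70|exact: c80|exact: c90|].
move=> Fc u gu p wFc Vu Lp sol beta gamma nF nW.
apply: concl.
- exact: (dnorm_pi1_ge0 leb oOm bOm s0 r0 wFc).
- exact: (dnorm_pi2_ge0 leb oOm bOm s0 r0 wFc).
- exact: Lnrm_ge0.
- exact: Lnrm_ge0.
- exact: (dnorm_pi1_le_W leb oOm bOm s0 r0 wFc).
- exact: (dnorm_pi2_le_W leb oOm bOm s0 r0 wFc).
- exact: (divergence_estimate leb oOm bOm s2 wFc Vu sol).
- exact: (pressure_estimate leb n0 oOm bOm s2 c10 Fn0 lipF wFc Vu Lp sol L0 inv).
- exact: (energy_estimate leb n0 oOm bOm s2 c10 Fn0 lipF monF wFc Vu Lp sol).
- exact: (lerD (Vnrm_le mu Om s2 u gu) (lexx _)).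
Qed.
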